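(* Let $p$ be an odd prime, let $n\ge 3$ be an odd integer, and let $f:\mathbb{F}_p^n\to\mathbb{F}_p$ be a non-weakly regular bent function belonging to $\mathcal{DBF}$. If $p\equiv1\pmod4$, assume that $B_+(f)$ and $B_+(f^* )$ are both non-degenerate $r$-dimensional subspaces over $\mathbb{F}_p$; if $p\equiv3\pmod 4$, assume that $B_-(f)$ and $B_+(f^* )$ are both non-degenerate $r$-dimensional subspaces over $\mathbb{F}_p$. (i) If $r=\frac{n+1}2$ and $p\equiv1\pmod4$, then $$U_{18}=\Big\{\{0\},\ c_0(f)\setminus\{0\},\ \bigcup_{i\in SQ}c_i(f),\ d_0(f),\ \bigcup_{i\in SQ}d_i(f),\ \bigcup_{i\in NSQ}d_i(f)\Big\}$$ is a partition of $\mathbb{F}_p^n$ and induces a $5$-class symmetric association scheme. (ii) If $r=\frac{n+1}2$ and $p\equiv3\pmod4$, then $$U_{19}=\Big\{\{0\},\ c_0(f)\setminus\{0\},\ \bigcup_{i\in NSQ}c_i(f),\ d_0(f),\ \bigcup_{i\in SQ}d_i(f),\ \bigcup_{i\in NSQ}d_i(f)\Big\}$$ is a partition of $\mathbb{F}_p^n$ and induces a $5$-class symmetric association scheme. (iii) If $\frac{n+1}2<r\le n-1$ and $p\equiv1\pmod4$, then $$U_{20}=\Big\{\{0\},\ B_+(f)^\bot\setminus\{0\},\ c_0(f)\setminus B_+(f)^\bot,\ \bigcup_{i\in SQ}c_i(f),\ \bigcup_{i\in NSQ}c_i(f),\ d_0(f),\ \bigcup_{i\in SQ}d_i(f),\ \bigcup_{i\in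 NSQ}d_i(f)\Big\}$$ is a partition of $\mathbb{F}_p^n$ and induces a $7$-class symmetric association scheme. (iv) If $\frac{n+1}2<r\le n-1$ and $p\equiv3\pmod4$, then $$U_{21}=\Big\{\{0\},\ B_-(f)^\bot\setminus\{0\},\ c_0(f)\setminus B_-(f)^\bot,\ \bigcup_{i\in SQ}c_i(f),\ \bigcup_{i\in NSQ}c_i(f),\ d_0(f),\ \bigcup_{i\in SQ}d_i(f),\ \bigcup_{i\in NSQ}d_i(f)\Big\}$$ is a partition of $\mathbb{F}_p^n$ and induces a $7$-class symmetric association scheme.
   Context: Let $p$ be an odd prime, $n$ a positive integer, $x\cdot y$ the ordinary inner product on $\mathbb{F}_p^n$, and $\xi_p=e^{2\pi\sqrt{-1}/p}$. $SQ$ and $NSQ$ denote the sets of squares and of nonsquares in $\mathbb{F}_p^*$. Bent functions. For $f:\mathbb{F}_p^n\to\mathbb{F}_p$ the Walsh transform is $\mathcal{W}_f(\alpha)=\sum_{x\in\mathbb{F}_p^n}\xi_p^{f(x)-\alpha\cdot x}$, $\alpha\in\mathbb{F}_p^n$; $f$ is bent if $|\mathcal{W}_f(\alpha)|=p^{n/2}$ for all $\alpha$. Put $\mu=1$ if $p^n\equiv1\pmod 4$ and $\mu=\sqrt{-1}$ if $p^n\equiv3\pmod4$. For a bent $f$ it is known that for every $\alpha$, $\mathcal{W}_f(\alpha)\in\{\mu p^{n/2}\xi_p^{f^*(\alpha)},-\mu p^{n/2}\xi_p^{f^*(\alpha)}\}$ for a (unique) function $f^*:\mathbb{F}_p^n\to\mathbb{F}_p$,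 called the dual of $f$. A bent $f$ is weakly regular if there is $\lambda\in\{\pm1,\pm\sqrt{-1}\}$ independent of $\alpha$ with $\mathcal{W}_f(\alpha)=\lambda p^{n/2}\xi_p^{f^*(\alpha)}$ for all $\alpha$; otherwise it is non-weakly regular. A bent $f$ is dual-bent if $f^*$ is also bent. For a bent function $f$: $B_+(f)=\{\alpha:\mathcal{W}_f(\alpha)=\mu p^{n/2}\xi_p^{f^*(\alpha)}\}$ and $B_-(f)=\{\alpha:\mathcal{W}_f(\alpha)=-\mu p^{n/2}\xi_p^{f^*(\alpha)}\}$. For $f$ dual-bent, $B_\pm(f^* )$ are defined by the same formulas applied to the bent function $f^*$. For dual-bent $f$ and $j\in\mathbb{F}_p$: $c_j(f)=\{x\in B_+(f^* ):f(x)=j\}$, $d_j(f)=\{x\in B_-(f^* ):f(x)=j\}$. $\mathcal{DBF}$ is the set of dual-bent functions $f:\mathbb{F}_p^n\to\mathbb{F}_p$ such that $f(0)=0$ and there is a positive integer $h$ with $\gcd(h-1,p-1)=1$ and $f(ax)=a^hf(x)$ for all $a\in\mathbb{F}_p^*$, $x\in\mathbb{F}_p^n$. For a subspace $V$ of $\mathbb{F}_p^n$, $V^\bot$ is its orthogonal complement with respect to $\cdot$; $V$ is non-degenerate if $\{x\in V:x\cdot y=0\ \text{for all } y\in V\}=\{0\}$. Association schemes. A $d$-class association scheme on a nonempty finite set $X$ is a partition of $X\times X$ into relations $R_0,\dots,R_d$ such that $R_0=\{(x,x):x\in X\}$; for each $j$ the transpose $R_j^T$ equals some $R_{j'}$;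 and for all $u,v,w$ and $(x,y)\in R_w$ the number $|\{z\in X:(x,z)\in R_u,(z,y)\in R_v\}|$ depends only on $u,v,w$. It is symmetric if $R_j^T=R_j$ for all $j$. A partition $\{U_i\}_{i=0}^d$ of $\mathbb{F}_p^n$ (into nonempty sets) with $U_0=\{0\}$ induces a $d$-class symmetric association scheme if the relations $R_i=\{(\alpha,\beta):\alpha-\beta\in U_i\}$, $0\le i\le d$, form a symmetric association scheme on $\mathbb{F}_p^n$. *)

(* Defs.v *)
From mathcomp Require Import all_boot all_order all_algebra.
From mathcomp Require Import complex reals trigo.

Set Implicit Arguments.
Unset Strict Implicit.
Unset Printing Implicit Defensive.

Import Order.TTheory GRing.Theory Num.Theory.
Local Open Scope ring_scope.
Local Open Scope complex_scope.

Definition dotp {p n : nat} (x y : 'rV['F_p]_n) : 'F_p :=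
  \sum_(i < n) x 0 i * y 0 i.

Definition orthoc {p n : nat} (A : {set 'rV['F_p]_n}) : {set 'rV['F_p]_n} :=
  [set x | [forall y in A, dotp x y == 0]].

Definition nondegenerate_subspace {p n : nat} (r : nat)
    (A : {set 'rV['F_p]_n}) : Prop :=
  exists V : {vspace 'rV['F_p]_n},
    [/\ A = [set x in V], (\dim V = r)%N
      & [set x in A | [forall y in A, dotp x y == 0]] = [set 0]].

Definition SQ (p : nat) : {set 'F_p} :=
  [set a | (a != 0) && [exists b : 'F_p, a == b ^+ 2]].

Definition NSQ (p : nat) : {set 'F_p} :=
  [set a | (a != 0) && ~~ [exists b : 'F_p, a == b ^+ 2]].

Definition xi (R : realType) (p : nat) : R[i] :=
  cos (pi *+ 2 / p%:R) +i* sin (pi *+ 2 / p%:R).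

(* The exponents a of [xi R p ^+ a] below are elements of 'F_p, coerced to
   their representatives in {0, ..., p - 1} (p prime). *)
Definition walsh (R : realType) {p n : nat} (f : 'rV['F_p]_n -> 'F_p)
    (alpha : 'rV['F_p]_n) : R[i] :=
  \sum_(x : 'rV['F_p]_n) xi R p ^+ (f x - dotp alpha x)%R.

Definition sqrt_pn (R : realType) (p n : nat) : R[i] :=
  (Num.sqrt (p%:R ^+ n))%:C.

Definition bent (R : realType) {p n : nat} (f : 'rV['F_p]_n -> 'F_p) : Prop :=
  forall alpha, `|walsh R f alpha| = sqrt_pn R p n.

(* mu = 1 or sqrt(-1); only used for p odd, where p ^ n is 1 or 3 modulo 4. *)
Definition mu (R : realType) (p n : nat) : R[i] :=
  if (p ^ n %% 4 == 1)%N then 1 else 'i.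

(* The dual f^* of a bent function f.  For p an odd prime and f bent, exactly
   one j satisfies the condition; the default value 0 is then never used. *)
Definition dual (R : realType) {p n : nat} (f : 'rV['F_p]_n -> 'F_p)
    (alpha : 'rV['F_p]_n) : 'F_p :=
  odflt 0 [pick j : 'F_p |
    (walsh R f alpha == mu R p n * sqrt_pn R p n * xi R p ^+ j)
    || (walsh R f alpha == - (mu R p n * sqrt_pn R p n * xi R p ^+ j))].

Definition weakly_regular (R : realType) {p n : nat}
    (f : 'rV['F_p]_n -> 'F_p) : Prop :=
  exists2 lambda : R[i], lambda \in [:: 1; - 1; 'i; - 'i] &
    forall alpha,
      walsh R f alpha = lambda * sqrt_pn R p n * xi R p ^+ (dual R f alpha).

Definition dual_bent (R : realType) {p n : nat}
    (f : 'rV['F_p]_n -> 'F_p) : Prop :=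
  bent R f /\ bent R (dual R f).

Definition Bplus (R : realType) {p n : nat} (f : 'rV['F_p]_n -> 'F_p) :
    {set 'rV['F_p]_n} :=
  [set alpha |
    walsh R f alpha == mu R p n * sqrt_pn R p n * xi R p ^+ (dual R f alpha)].

Definition Bminus (R : realType) {p n : nat} (f : 'rV['F_p]_n -> 'F_p) :
    {set 'rV['F_p]_n} :=
  [set alpha |
    walsh R f alpha
    == - (mu R p n * sqrt_pn R p n * xi R p ^+ (dual R f alpha))].

Definition cset (R : realType) {p n : nat} (f : 'rV['F_p]_n -> 'F_p)
    (j : 'F_p) : {set 'rV['F_p]_n} :=
  [set x in Bplus R (dual R f) | f x == j].

Definition dset (R : realType) {p n : nat} (f : 'rV['F_p]_n -> 'F_p)
    (j : 'F_p) : {set 'rV['F_p]_n} :=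
  [set x in Bminus R (dual R f) | f x == j].

Definition DBF (R : realType) {p n : nat} (f : 'rV['F_p]_n -> 'F_p) : Prop :=
  [/\ dual_bent R f, f 0 = 0
    & exists h : nat,
        [/\ (0 < h)%N, gcdn (h - 1) (p - 1) = 1%N
          & forall (a : 'F_p) (x : 'rV['F_p]_n), a != 0 ->
              f (a *: x) = a ^+ h * f x]].

(* A family of pairwise distinct nonempty sets partitioning the type T;
   [partition] already excludes the empty set. *)
Definition indexed_partition {T : finType} {d : nat}
    (U : 'I_d.+1 -> {set T}) : Prop :=
  injective U /\ partition [set U i | i : 'I_d.+1] [set: T].

Definition transpose {X : finType} (R : {set X * X}) : {set X * X} :=
  [set xy | (xy.2, xy.1) \in R].

(* The underlying set X is nonempty because R_0 is. *)
Definition assoc_scheme {X : finType} {d : nat}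
    (R : 'I_d.+1 -> {set X * X}) : Prop :=
  [/\ indexed_partition R,
      R ord0 = [set xy | xy.1 == xy.2],
      forall j, exists j', transpose (R j) = R j'
    & forall u v w, exists m : nat, forall x y, (x, y) \in R w ->
        #|[set z | ((x, z) \in R u) && ((z, y) \in R v)]| = m].

Definition symmetric_assoc_scheme {X : finType} {d : nat}
    (R : 'I_d.+1 -> {set X * X}) : Prop :=
  assoc_scheme R /\ forall j, transpose (R j) = R j.

Definition difference_relation {p n : nat} (A : {set 'rV['F_p]_n}) :
    {set 'rV['F_p]_n * 'rV['F_p]_n} :=
  [set ab | ab.1 - ab.2 \in A].

Definition induces_symmetric_scheme {p n : nat} (d : nat)
    (U : d.+1.-tuple {set 'rV['F_p]_n}) : Prop :=
  [/\ indexed_partition (tnth U), tnth U ord0 = [set 0]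
    & symmetric_assoc_scheme (fun i => difference_relation (tnth U i))].

Arguments induces_symmetric_scheme {p n} d U.

Definition U18 (R : realType) {p n : nat} (f : 'rV['F_p]_n -> 'F_p) :
    6.-tuple {set 'rV['F_p]_n} :=
  [tuple [set 0]; cset R f 0 :\ 0; \bigcup_(i in SQ p) cset R f i;
         dset R f 0; \bigcup_(i in SQ p) dset R f i;
         \bigcup_(i in NSQ p) dset R f i].

Definition U19 (R : realType) {p n : nat} (f : 'rV['F_p]_n -> 'F_p) :
    6.-tuple {set 'rV['F_p]_n} :=
  [tuple [set 0]; cset R f 0 :\ 0; \bigcup_(i in NSQ p) cset R f i;
         dset R f 0; \bigcup_(i in SQ p) dset R f i;
         \bigcup_(i in NSQ p) dset R f i].

Definition U20 (R : realType) {p n : nat} (f : 'rV['F_p]_n -> 'F_p) :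
    8.-tuple {set 'rV['F_p]_n} :=
  [tuple [set 0]; orthoc (Bplus R f) :\ 0; cset R f 0 :\: orthoc (Bplus R f);
         \bigcup_(i in SQ p) cset R f i; \bigcup_(i in NSQ p) cset R f i;
         dset R f 0; \bigcup_(i in SQ p) dset R f i;
         \bigcup_(i in NSQ p) dset R f i].

Definition U21 (R : realType) {p n : nat} (f : 'rV['F_p]_n -> 'F_p) :
    8.-tuple {set 'rV['F_p]_n} :=
  [tuple [set 0]; orthoc (Bminus R f) :\ 0; cset R f 0 :\: orthoc (Bminus R f);
         \bigcup_(i in SQ p) cset R f i; \bigcup_(i in NSQ p) cset R f i;
         dset R f 0; \bigcup_(i in SQ p) dset R f i;
         \bigcup_(i in NSQ p) dset R f i].

(* Main.v *)
(** Write e(a) = xi^a and let G be the quadratic Gauss sum, so that for n odd the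
    constant g = mu p^(n/2) is p^((n-1)/2) G; this uses the sign of G.  In Z[xi]
    the only elements whose squared norm is p^(2k) are +-p^k e(j), which makes the
    dual of a bent function well defined.  Reducing modulo 2 one gets f** = f and
    f*(0) = 0, and then, with S = B_+(f* ) and A = B_+(f) or B_-(f) according to
    p mod 4, the Fourier transform of 1_A e(f* ) is g 1_S e(f), and that of
    1_(~A) e(f* ) is -g 1_(~S) e(f).

    Applying the automorphisms xi -> xi^c and using that f is homogeneous of degree h
    while S is a subspace, 1_A e(c f* ) is transformed into
    eta(c) g 1_S e(c^(1-h) f) for every c <> 0, where eta is the quadratic character.
    Averaging over c shows that the indicator functions of the classes
    x = 0, x in orth(A), x in S, eta(f x) are transformed into functions
    constant on the analogous classes for f*, and conversely by Fourier inversion.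
    Since a convolution is the inverse transform of a product, the convolution of two
    class indicators is constant on the classes: this is the association scheme.  The
    same formulas at 0 count the classes and decide which of them are empty. *)
Require Import Defs.
From mathcomp Require Import all_boot all_order all_algebra.
From mathcomp Require Import complex reals trigo.
From mathcomp Require Import cyclic finfield.
From mathcomp Require Import ring lra zify.

Set Implicit Arguments.
Unset Strict Implicit.
Unset Printing Implicit Defensive.
Import Order.TTheory GRing.Theory Num.Theory.
Local Open Scope ring_scope.

(** * Quadratic residues modulo p *)

(** The side A depends on p mod 4 because g^* = eta(-1) g: the values of the dual have two known
    transforms, one with the factor g and one, weighted by the signs of the Walsh values, with the
    factor g^*, and only with this choice do they combine into indicators. The condition gcd(h-1,
    p-1) = 1 acts twice. It makes c -> c^(1-h) a permutation, and, p - 1 being even, it makes h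
    even, so that eta(c^(1-h)) = eta(c). Averaging over c without weight then turns a zero test on
    one side into a quadratic character on the other, and averaging with weight eta(c) does the
    reverse. The transform of 1_A lives on orth(A), which therefore has to be a union of classes; it
    lies among the zeros of f on S. There are p^(n-r) points in orth(A) and p^(r-1) zeros on S.
    These numbers agree for r = (n+1)/2, when moreover only one quadratic character occurs on S:
    hence five classes there and seven for larger r. Galois theory and arithmetic in Z[xi] are done
    by hand: all relations between the powers of xi come from their sum being 0, and 1 - xi is the
    only prime used. *)

Lemma even_of_coprime_pred p h : (0 < p)%N -> odd p -> (0 < h)%N ->
  coprime (h - 1) (p - 1) -> ~~ odd h.
Proof.
move=> p_gt0 p_odd; have : ~~ odd (p - 1) by rewrite oddB // p_odd.
case: h => // k op _; rewrite subSS subn0 /= negbK => ck.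
(* An odd [h] would make 2 a common divisor of [h - 1] and [p - 1]. *)
apply: contraTT ck => ok; apply/negP => /eqP ck.
have : (2 %| gcdn k (p - 1))%N by rewrite dvdn_gcd !dvdn2 ok op.
by rewrite ck.
Qed.

Section Legendre.

Variable p : nat.
Hypotheses (p_pr : prime p) (p_odd : odd p).

Let p_gt1 : (1 < p)%N := prime_gt1 p_pr.
Let p1_gt0 : (0 < p.-1)%N. Proof. by rewrite -subn1 subn_gt0. Qed.

Lemma p_half : p.-1 = (p./2).*2.
Proof. by rewrite -{1}(odd_double_half p) p_odd. Qed.

Lemma Fp_fermat (a : 'F_p) : a != 0 -> a ^+ p.-1 = 1.
Proof.
move=> a0; apply: (mulfI a0); rewrite -exprS prednK ?prime_gt0 // mulr1.
by have := expf_card a; rewrite card_Fp.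
Qed.

Lemma Fp_prim_root : exists g : 'F_p, p.-1.-primitive_root g.
Proof.
pose rs := [seq x <- enum 'F_p | x != 0].
have : has p.-1.-primitive_root rs.
  apply: has_prim_root => //.
  - apply/allP => x; rewrite mem_filter => /andP [x0 _].
    by rewrite unity_rootE Fp_fermat.
  - by rewrite filter_uniq ?enum_uniq.
  have := cardC1 (0 : 'F_p); rewrite card_Fp // cardE /enum_mem -enumT => <-.
  by rewrite /rs enumT /=; apply: eq_leq; congr size; apply: eq_filter.
by case/hasP => g _ gP; exists g.
Qed.

Lemma Fp_prim_pow g (a : 'F_p) : p.-1.-primitive_root g -> a != 0 ->
  exists k, a = g ^+ k.
Proof.
move=> gP /Fp_fermat ap; have [k ->] := prim_rootP gP ap.
by exists k.
Qed.

(** Multiplication by a primitive root g permutes the terms and scales the sum by g^k, which is not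
    1 for 0 < k < p - 1; for k = 0 the sum is p. *)
Lemma Fp_sum_expr k : (k < p.-1)%N -> \sum_(a : 'F_p) a ^+ k = 0.
Proof.
move=> kp; have [g gP] := Fp_prim_root.
case: k kp => [|k] kp.
  rewrite (eq_bigr (fun=> 1)) ?sumr_const ?card_Fp //.
  by rewrite -pchar_Fp_0.
have g0 : g != 0 by rewrite (prim_root_eq0 gP) -lt0n.
have gk : 1 - g ^+ k.+1 != 0.
  rewrite subr_eq0 -(expr0 g) (eq_prim_root_expr gP) mod0n eq_sym.
  by rewrite modn_small.
apply: (mulfI gk); rewrite mulr0 mulrBl mul1r mulr_sumr.
rewrite [X in X - _](reindex_inj (mulfI g0)) /=.
by rewrite -sumrB big1 // => a _; rewrite exprMn subrr.
Qed.

Lemma Fp_sum_exprp1 : \sum_(a : 'F_p) a ^+ p.-1 = -1.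
Proof.
rewrite (bigD1 0) //= expr0n gtn_eqF // add0r.
rewrite (eq_bigr (fun=> 1)) => [|a a0]; last exact: Fp_fermat.
rewrite sumr_const -[X in _ *+ X](_ : p.-1 = _); last first.
  by have := cardC1 (0 : 'F_p); rewrite card_Fp // => <-.
by apply: (addIr 1); rewrite addNr -mulrSr prednK ?prime_gt0 ?pchar_Fp_0.
Qed.

Lemma Fp_expr_inj k : coprime k p.-1 ->
  {in [pred a : 'F_p | a != 0] &, injective (fun a => a ^+ k)}.
Proof.
move=> ck a b; rewrite !inE => a0 b0 /= ab.
have [g gP] := Fp_prim_root.
have [i aE] := Fp_prim_pow gP a0; have [j bE] := Fp_prim_pow gP b0.
move/eqP: ab; rewrite aE bE -!exprM (eq_prim_root_expr gP) => h.
apply/eqP; rewrite (eq_prim_root_expr gP).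
wlog ji : i j {a b a0 b0 aE bE} h / (j <= i)%N.
  move=> H; case: (leqP j i) => [|/ltnW] ij; [|rewrite eq_sym];
    by apply: H; rewrite // eq_sym.
move: h; rewrite !eqn_mod_dvd ?leq_mul2r ?ji ?orbT // -mulnBl.
by rewrite Gauss_dvdl // coprime_sym.
Qed.

(** Integer values let the character be used both as a coefficient in Z[xi] and, reduced modulo p,
    in F_p. *)
Definition legendre (a : 'F_p) : int :=
  if a == 0 then 0 else if [exists b : 'F_p, a == b ^+ 2] then 1 else -1.
Local Notation eta := legendre.

Lemma half_sqr (a : 'F_p) : a != 0 -> (a ^+ p./2 == 1) || (a ^+ p./2 == -1).
Proof.
by move=> a0; rewrite -sqrf_eq1 -exprM muln2 -p_half Fp_fermat.
Qed.

Lemma Fp_two_neq0 : 2%:R != 0 :> 'F_p.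
Proof.
rewrite -(dvdn_pcharf (pchar_Fp p_pr)); apply/negP => /(@dvdn_leq p 2 isT) p2.
by move: p_odd; rewrite (_ : p = 2%N) //; apply/eqP; rewrite eqn_leq p2.
Qed.

Lemma Fp_m1_neq1 : -1 != 1 :> 'F_p.
Proof. by rewrite eq_sym -subr_eq0 opprK (_ : 1 + 1 = 2%:R) ?Fp_two_neq0. Qed.

(** For the converse, write a as the k-th power of a primitive root: a^((p-1)/2) = 1 forces k to be
    even. *)
Lemma euler_criterion (a : 'F_p) : a != 0 ->
  [exists b : 'F_p, a == b ^+ 2] = (a ^+ p./2 == 1).
Proof.
move=> a0; apply/existsP/idP => [[b /eqP aE]|].
  rewrite aE -exprM mul2n -p_half Fp_fermat //.
  by apply: contraNneq a0; rewrite aE => ->; rewrite expr0n.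
have [g gP] := Fp_prim_root; have [k ->] := Fp_prim_pow gP a0.
rewrite -exprM -(prim_order_dvd gP) p_half -muln2 mulnC dvdn_pmul2r.
  by move=> /dvdnP [q ->]; exists (g ^+ q); rewrite exprM.
by rewrite -double_gt0 -p_half.
Qed.

Lemma legendreE (a : 'F_p) : (eta a)%:~R = a ^+ p./2.
Proof.
rewrite /eta; case: eqP => [->|/eqP a0].
  by rewrite expr0n gtn_eqF // -double_gt0 -p_half.
rewrite euler_criterion //; case: ifP => [/eqP ->//|h].
by have := half_sqr a0; rewrite h /= => /eqP ->; rewrite rmorphN1.
Qed.

Lemma legendre0 : eta 0 = 0. Proof. by rewrite /eta eqxx. Qed.

Lemma legendre_sqr a : a != 0 -> eta a ^+ 2 = 1.
Proof. by rewrite /eta => /negPf ->; case: ifP. Qed.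

Lemma legendre_cases a : [\/ eta a = 0, eta a = 1 | eta a = -1].
Proof.
by rewrite /eta; case: ifP => _; [constructor 1|case: ifP; [constructor 2|constructor 3]].
Qed.

Lemma legendre_intr_inj a b : (eta a)%:~R = (eta b)%:~R :> 'F_p -> eta a = eta b.
Proof.
have h1 := oner_neq0 'F_p; have hm := Fp_m1_neq1.
have h2 : (-1 : 'F_p) != 0 by rewrite oppr_eq0.
case: (legendre_cases a) => ->; case: (legendre_cases b) => -> //;
  rewrite ?rmorphN1 ?rmorph0 ?rmorph1 => /eqP; rewrite 1?eq_sym;
  by rewrite ?(negPf h1, negPf h2, negPf hm) 1?eq_sym ?(negPf h1, negPf h2, negPf hm).
Qed.

Lemma legendreM (a b : 'F_p) : eta (a * b) = eta a * eta b.
Proof.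
have : (eta (a * b))%:~R = (eta a * eta b)%:~R :> 'F_p.
  by rewrite rmorphM /= !legendreE exprMn.
(* Multiplicativity is clear in F_p by Euler's criterion. It lifts to the integers because both
   sides are values of eta, which are distinct modulo p. *)
have [c ->] : exists c, eta a * eta b = eta c; last exact: legendre_intr_inj.
case: (legendre_cases a) => aE; rewrite aE.
- by exists 0; rewrite legendre0 mul0r.
- by exists b; rewrite mul1r.
case: (legendre_cases b) => bE; rewrite bE.
- by exists 0; rewrite legendre0.
- by exists a; rewrite aE.
exists 1; rewrite /eta oner_eq0 mulrNN mulr1; case: existsP => // [[]].
by exists 1; rewrite expr1n.
Qed.

Lemma legendre1 : eta 1 = 1.
Proof. by have := legendre_sqr (oner_neq0 'F_p); rewrite expr2 -legendreM mulr1. Qed.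

Lemma legendreX a k : eta (a ^+ k) = eta a ^+ k.
Proof. by elim: k => [|k IH]; rewrite ?legendre1 // !exprS legendreM IH. Qed.

Lemma legendreN1 : eta (-1) = (-1) ^+ p./2.
Proof.
have h : (eta (-1))%:~R = (-1) ^+ odd p./2 :> 'F_p by rewrite legendreE signr_odd.
rewrite -signr_odd; move: h; case: (odd _); case: (legendre_cases (-1)) => -> //= /eqP.
- by rewrite eq_sym oppr_eq0 oner_eq0.
- by rewrite eq_sym (negPf Fp_m1_neq1).
by rewrite expr0 rmorphN1 (negPf Fp_m1_neq1).
Qed.

Lemma legendreN1_mod4 : eta (-1) = if (p %% 4 == 1)%N then 1 else -1.
Proof.
rewrite legendreN1 -signr_odd.
have pE : p = (p./2).*2.+1 by rewrite -[LHS]odd_double_half p_odd.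
have : odd p./2 = ~~ (p %% 4 == 1)%N.
  rewrite [in RHS]pE -[p./2 in RHS]odd_double_half -!muln2.
  by case: (odd p./2) => /=; lia.
by move=> ->; case: eqP.
Qed.

End Legendre.

(** * Cyclotomic integers and Gauss sums *)

Section CyclotomicIntegers.

Variables (p : nat) (C : numClosedFieldType) (z : C).
Hypotheses (p_pr : prime p) (z_prim : p.-primitive_root z).

Definition ezeta (a : 'F_p) : C := z ^+ a.
Local Notation e := ezeta.

Let p_gt0 : (0 < p)%N := prime_gt0 p_pr.

Lemma ezeta_nat k : e k%:R = z ^+ k.
Proof. by rewrite /e val_Fp_nat // prim_expr_mod. Qed.

Lemma FpE (a : 'F_p) : a = (val a)%:R.
Proof. by rewrite natr_Zp. Qed.

Lemma ezetaD a b : e (a + b) = e a * e b.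
Proof. by rewrite (FpE a) (FpE b) -natrD !ezeta_nat exprD. Qed.

Lemma ezeta0 : e 0 = 1.
Proof. by rewrite /e expr0. Qed.

Lemma ezeta_neq0 a : e a != 0.
Proof.
rewrite expf_neq0 // (prim_root_eq0 z_prim) -lt0n //.
Qed.

Lemma ezetaN a : e (- a) = (e a)^-1.
Proof.
by apply: (mulIf (ezeta_neq0 a)); rewrite -ezetaD addNr ezeta0 mulVf ?ezeta_neq0.
Qed.

Lemma ezeta_norm a : `|e a| = 1.
Proof.
have : `|e a| ^+ p = 1.
  by rewrite -normrX /e -exprM mulnC exprM (prim_expr_order z_prim) expr1n normr1.
by move/eqP; rewrite pexpr_eq1 // => /eqP.
Qed.

Lemma ezeta_conj a : (e a)^* = e (- a).
Proof. by rewrite ezetaN invC_norm ezeta_norm expr1n invr1 mul1r. Qed.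

Lemma ezeta_inj : injective e.
Proof.
move=> a b /eqP; rewrite (eq_prim_root_expr z_prim) => /eqP.
by rewrite !modn_small -?[X in (_ < X)%N](Fp_cast p_pr) ?ltn_ord // => /val_inj.
Qed.

Lemma ezeta_sum (b : 'F_p) : \sum_a e (a * b) = if b == 0 then p%:R else 0.
Proof.
case: eqP => [->|/eqP b0].
  rewrite (eq_bigr (fun=> 1)) => [|a _]; last by rewrite mulr0 ezeta0.
  by rewrite sumr_const card_Fp.
have e1 : e b != 1 by rewrite -ezeta0 (inj_eq ezeta_inj).
apply: (mulIf (x := e b - 1)); first by rewrite subr_eq0.
rewrite mul0r mulrBr mulr1 mulr_suml; apply/eqP; rewrite subr_eq0; apply/eqP.
rewrite [RHS](reindex_inj (addrI 1)) /=.
by apply: eq_bigr => a _; rewrite mulrDl mul1r ezetaD mulrC.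
Qed.


(** * Linear relations between the p-th roots of unity *)

Local Notation ev P := (map_poly (intr : int -> C) P).[z].

(* The cyclotomic polynomial evaluated at X + 1, to which Eisenstein applies. *)
Definition cyclo_shift : {poly int} := \poly_(i < p) ('C(p, i.+1))%:R.

Lemma size_cyclo_shift : size cyclo_shift = p.
Proof.
by rewrite /cyclo_shift size_poly_eq // prednK // binn.
Qed.

Lemma coef_cyclo_shift i : cyclo_shift`_i = ('C(p, i.+1))%:R.
Proof.
rewrite coef_poly; case: ltnP => // le_pi; by rewrite bin_small.
Qed.

Lemma cyclo_shift_irreducible : irreducible_poly cyclo_shift.
Proof.
have p_gt1 := prime_gt1 p_pr.
apply: (eisenstein_crit p_pr).
- by rewrite size_cyclo_shift neq_ltn p_gt1 orbT.
- rewrite lead_coefE size_cyclo_shift coef_cyclo_shift prednK // binn.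
  by rewrite dvdz1 /= neq_ltn p_gt1 orbT.
- rewrite coef_cyclo_shift bin1 natz dvdzE /=.
  apply/negP => /(dvdn_leq p_gt0).
  by rewrite -[(p ^+ 2)%R]/(p * p)%N leqNgt ltn_Pmull.
- move=> i; rewrite size_cyclo_shift coef_cyclo_shift => ip.
  rewrite natz dvdzE /=; apply: prime_dvd_bin => //=.
  by rewrite -ltn_predRL.
Qed.

Lemma cyclo_shift_root : root (map_poly (intr : int -> C) cyclo_shift) (z - 1).
Proof.
have z1 : z - 1 != 0.
  rewrite subr_eq0 -{1}(expr1 z) -(expr0 z) (eq_prim_root_expr z_prim).
  by rewrite mod0n modn_small // prime_gt1.
apply/eqP; apply: (mulIf z1); rewrite mul0r.
rewrite horner_coef size_map_poly_id0; last first.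
  by rewrite intr_eq0 lead_coef_eq0 -size_poly_eq0 size_cyclo_shift -lt0n.
rewrite size_cyclo_shift.
have := exprD1n (z - 1) p; rewrite subrK (prim_expr_order z_prim) big_ord_recl.
rewrite expr0 bin0 => /eqP; rewrite eq_sym -subr_eq0 addrAC subrr add0r => /eqP.
rewrite mulr_suml => H; rewrite -[RHS]H; apply: eq_bigr => i _.
rewrite coef_map /= coef_cyclo_shift -mulrA -exprSr /bump /= add1n.
by rewrite natz -pmulrn mulr_natl.
Qed.

(** P(X + 1) and the irreducible [cyclo_shift] share the root z - 1. If P were nonzero, its degree
    below p - 1 would make the two coprime over the rationals. *)
Lemma int_poly_root0 (P : {poly int}) : (size P < p)%N -> ev P = 0 -> P = 0.
Proof.
move=> sP P0; apply/eqP; apply: contraT => nzP.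
pose pQ := map_poly (intr : int -> rat).
have irrE : irreducible_poly (pQ cyclo_shift).
  exact/irreducible_rat_int/cyclo_shift_irreducible.
pose Q := P \Po ('X + 1).
have sQ : size Q = size P by rewrite size_comp_poly2 // -polyC1 size_XaddC.
have injQ : injective (intr : int -> rat) by exact: intr_inj.
have := irreducible_poly_coprime (pQ Q) irrE.
have -> : ~~ (pQ cyclo_shift %| pQ Q) = true.
  apply/negP => /dvdp_leq; rewrite -size_poly_eq0.
  rewrite !size_map_inj_poly // sQ size_cyclo_shift size_poly_eq0 => /(_ nzP).
  by rewrite leqNgt sP.
rewrite -(coprimep_map (ratr : rat -> C)) => /coprimep_root.
have evQ (D : {poly int}) : map_poly (ratr : rat -> C) (pQ D) = map_poly intr D.
  by rewrite -map_poly_comp; apply: eq_map_poly => a /=; rewrite ratr_int.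
rewrite !evQ => /(_ _ cyclo_shift_root) /negP; case.
by rewrite /Q map_comp_poly /= rmorphD /= map_polyX rmorph1 horner_comp !hornerE subrK P0.
Qed.

Lemma ezeta_free (a : 'F_p -> int) :
  \sum_j (a j)%:~R * e j = 0 -> forall i j, a i = a j.
Proof.
move=> a0.
suff H j : a j = a (-1) by move=> i j; rewrite !H.
(* The representative of -1 is p - 1, so subtracting [a (-1)] kills the top coefficient and brings
   the degree below p - 1; the value at z does not change, since the powers of z sum to 0. *)
pose P := \sum_j (a j - a (-1)) *: 'X^j : {poly int}.
have evP : ev P = 0.
  rewrite /P rmorph_sum horner_sum /=.
  rewrite (eq_bigr (fun j => (a j)%:~R * e j - (a (-1))%:~R * e j)); last first.
    move=> k _; rewrite linearZ /= map_polyXn hornerZ hornerXn /ezeta.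
    by rewrite rmorphB mulrBl.
  rewrite sumrB a0 -mulr_sumr (_ : \sum_i e i = 0) ?mulr0 ?subr0 //.
  have := ezeta_sum 1; rewrite oner_eq0 => s0; rewrite -[RHS]s0.
  by apply: eq_bigr => k _; rewrite mulr1.
have valM1 : val (-1 : 'F_p) = p.-1.
  apply/eqP; rewrite -eqSS prednK //.
  have := congr1 (@nat_of_ord _) (addNr (1 : 'F_p)).
  have lt := ltn_ord (-1 : 'F_p); rewrite [X in (_ < X)%N](Fp_cast p_pr) in lt.
  rewrite /= [X in (_ %% X)%N](Fp_cast p_pr) [X in (_ + X)%N]modn_small; last first.
    by rewrite [X in (_ < X)%N](Fp_cast p_pr) prime_gt1.
  rewrite addn1 => h.
  by rewrite eqn_leq lt /=; apply: dvdn_leq => //; rewrite /dvdn h.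
have coefP (k : 'F_p) : P`_k = a k - a (-1).
  rewrite /P coef_sum (bigD1 k) //= coefZ coefXn eqxx mulr1 big1 ?addr0 // => i ik.
  by rewrite coefZ coefXn (inj_eq val_inj) eq_sym (negPf ik) mulr0.
have P0 : P = 0.
  apply: int_poly_root0 => //; rewrite -[X in (_ < X)%N](prednK p_gt0) ltnS.
  apply/leq_sizeP => i; rewrite leq_eqVlt => /orP [/eqP <-|ip].
    by rewrite -valM1 coefP subrr.
  rewrite /P coef_sum big1 // => k _; rewrite coefZ coefXn.
  have := ltn_ord k; rewrite [X in (_ < X)%N](Fp_cast p_pr) => kp.
  by rewrite gtn_eqF ?mulr0 //; apply: leq_trans kp _; rewrite -(prednK p_gt0).
by apply/eqP; rewrite -subr_eq0 -coefP P0 coef0.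
Qed.

Lemma ezeta_sum0 : \sum_j e j = 0.
Proof.
have := ezeta_sum 1; rewrite oner_eq0 => s0; rewrite -[RHS]s0.
by apply: eq_bigr => k _; rewrite mulr1.
Qed.

Lemma ezeta_collect (I : finType) (n : I -> int) (k : I -> 'F_p) (c : 'F_p) :
  \sum_i (n i)%:~R * e (c * k i) =
  \sum_j (\sum_(i | k i == j) n i)%:~R * e (c * j).
Proof.
rewrite (partition_big k predT) //=; apply: eq_bigr => j _.
by rewrite rmorph_sum mulr_suml; apply: eq_bigr => i /eqP ->.
Qed.

Lemma ezeta_free_sum (I : finType) (n : I -> int) (k : I -> 'F_p) :
  \sum_i (n i)%:~R * e (k i) = 0 ->
  forall j1 j2, \sum_(i | k i == j1) n i = \sum_(i | k i == j2) n i.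
Proof.
move=> h; apply: ezeta_free; rewrite -[RHS]h.
have := ezeta_collect n k 1.
by under eq_bigr do rewrite mul1r; under [RHS]eq_bigr do rewrite mul1r.
Qed.

(** This is the automorphism z -> z^c without constructing it: after collecting equal exponents all
    coefficients of a relation coincide, and the powers of z^c also sum to 0. *)
Lemma ezeta_galois (I J : finType) (n : I -> int) (k : I -> 'F_p)
    (m : J -> int) (l : J -> 'F_p) (c : 'F_p) : c != 0 ->
  \sum_i (n i)%:~R * e (k i) = \sum_j (m j)%:~R * e (l j) ->
  \sum_i (n i)%:~R * e (c * k i) = \sum_j (m j)%:~R * e (c * l j).
Proof.
move=> c0 h; apply/eqP; rewrite -subr_eq0.
pose a j := \sum_(i | k i == j) n i - \sum_(i | l i == j) m i.
have aE d : \sum_j (a j)%:~R * e (d * j) = \sum_i (n i)%:~R * e (d * k i)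
    - \sum_j (m j)%:~R * e (d * l j).
  rewrite (ezeta_collect n) (ezeta_collect m) -sumrB; apply: eq_bigr => j _.
  by rewrite /a rmorphB mulrBl.
have a1 : \sum_j (a j)%:~R * e j = 0.
  have := aE 1; under eq_bigr do rewrite mul1r.
  under [X in X - _]eq_bigr do rewrite mul1r.
  under [X in _ - X]eq_bigr do rewrite mul1r.
  by rewrite h subrr.
have ac := ezeta_free a1.
rewrite -aE (eq_bigr (fun j => (a 0)%:~R * e (j * c))) => [|j _]; last first.
  by rewrite (ac j 0) [c * j]mulrC.
by rewrite -mulr_sumr ezeta_sum (negPf c0) mulr0.
Qed.

Lemma poly_ezeta (P : {poly int}) :
  ev P = \sum_(i < size P) (P`_i)%:~R * e i%:R.
Proof.
rewrite horner_coef; case: (eqVneq P 0) => [->|nzP].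
  by rewrite rmorph0 !size_poly0 !big_ord0.
rewrite size_map_poly_id0 ?intr_eq0 ?lead_coef_eq0 //.
by apply: eq_bigr => i _; rewrite coef_map ezeta_nat.
Qed.

(** * Arithmetic of Z[xi] at the prime 1 - xi *)

Definition cycint (x : C) := exists P : {poly int}, x = ev P.

Lemma cycint_poly P : cycint (ev P). Proof. by exists P. Qed.

Lemma cycint_sum (I : finType) (n : I -> int) (k : I -> 'F_p) :
  cycint (\sum_i (n i)%:~R * e (k i)).
Proof.
exists (\sum_i (n i) *: 'X^(k i)); rewrite rmorph_sum horner_sum /=.
by apply: eq_bigr => i _; rewrite linearZ /= map_polyXn hornerZ hornerXn.
Qed.

Lemma cycintP x : cycint x -> exists a : 'F_p -> int, x = \sum_j (a j)%:~R * e j.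
Proof.
case=> P ->; rewrite poly_ezeta.
exists (fun j => \sum_(i < size P | i%:R == j) P`_i).
have := ezeta_collect (fun i : 'I_(size P) => P`_i) (fun i => i%:R) 1.
by under eq_bigr do rewrite mul1r; under [RHS]eq_bigr do rewrite mul1r.
Qed.

Lemma cycint_e j : cycint (e j).
Proof. by exists 'X^j; rewrite map_polyXn hornerXn. Qed.

Lemma cycint_int (m : int) : cycint m%:~R.
Proof. by exists m%:P; rewrite map_polyC hornerC. Qed.

Lemma cycintM x y : cycint x -> cycint y -> cycint (x * y).
Proof. by move=> [P ->] [Q ->]; exists (P * Q); rewrite rmorphM hornerM. Qed.

Lemma cycintD x y : cycint x -> cycint y -> cycint (x + y).
Proof. by move=> [P ->] [Q ->]; exists (P + Q); rewrite rmorphD hornerD. Qed.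

Lemma cycintN x : cycint x -> cycint (- x).
Proof. by move=> [P ->]; exists (- P); rewrite rmorphN hornerN. Qed.

Lemma cycint_prod (I : Type) (r : seq I) (Q : pred I) (F : I -> C) :
  (forall i, Q i -> cycint (F i)) -> cycint (\prod_(i <- r | Q i) F i).
Proof.
move=> h; elim/big_ind: _ => //; first exact: (cycint_int 1).
exact: cycintM.
Qed.

Lemma cycintX x k : cycint x -> cycint (x ^+ k).
Proof. by move=> [P ->]; exists (P ^+ k); rewrite rmorphXn horner_exp. Qed.

Lemma cycint_bigsum (I : Type) (r : seq I) (Q : pred I) (F : I -> C) :
  (forall i, Q i -> cycint (F i)) -> cycint (\sum_(i <- r | Q i) F i).
Proof.
move=> h; elim/big_ind: _ => //; first exact: (cycint_int 0).
exact: cycintD.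
Qed.

Lemma conj_poly P : (ev P)^* = ev (P \Po 'X^(p.-1)).
Proof.
rewrite map_comp_poly map_polyXn horner_comp hornerXn -horner_map -map_poly_comp.
have -> : map_poly (Num.conj \o (intr : int -> C)) P = map_poly intr P.
  by apply: eq_map_poly => a /=; rewrite rmorph_int.
congr _.[_]; have := ezeta_conj 1; rewrite {1}/e /=.
rewrite /e modn_small ?(Fp_cast p_pr) ?prime_gt1 // expr1 => ->.
have := ezetaN 1; rewrite /e /= => ->.
rewrite modn_small ?(Fp_cast p_pr) ?prime_gt1 // expr1.
have z0 : z != 0 by rewrite (prim_root_eq0 z_prim) -lt0n.
by apply: (mulfI z0); rewrite mulfV // -exprS prednK // (prim_expr_order z_prim).
Qed.

Lemma cycint_conj x : cycint x -> cycint x^*.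
Proof. by move=> [P ->]; rewrite conj_poly; apply: cycint_poly. Qed.

(* The sum of the coefficients is well defined modulo p on Z[xi]: it is the residue
   map of the prime 1 - xi. *)
Lemma aug_wd P : ev P = 0 -> (p %| P.[1])%Z.
Proof.
rewrite poly_ezeta => h.
have := ezeta_free_sum h => hc.
have -> : P.[1] = \sum_(i < size P) P`_i.
  by rewrite horner_coef; apply: eq_bigr => i _; rewrite expr1n mulr1.
rewrite (partition_big (fun i : 'I_(size P) => (i%:R : 'F_p)) predT) //=.
rewrite (eq_bigr (fun=> \sum_(i < size P | i%:R == 0 :> 'F_p) P`_i)) => [|j _].
  by rewrite sumr_const card_Fp // -mulr_natr natz dvdz_mull.
exact: hc.
Qed.

Lemma ezeta1E : e 1 = z.
Proof. by rewrite -[RHS]expr1 -(ezeta_nat 1). Qed.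

(** Both sides are the value at 1 of (X^p - 1)/(X - 1). *)
Lemma prod_sub_ezeta : \prod_(j : 'F_p | j != 0) (1 - e j) = p%:R.
Proof.
pose S : {poly C} := \sum_(i < p) 'X^i.
have prodS : \prod_(j : 'F_p | j != 0) ('X - (e j)%:P) = S.
  have X1 : 'X - 1 != 0 :> {poly C} by rewrite polyXsubC_eq0.
  apply: (mulfI X1); rewrite -subrX1 -(factor_Xn_sub_1 z_prim).
  transitivity (\prod_(j : 'F_p) ('X - (e j)%:P)).
    by rewrite [RHS](bigD1 0) //= ezeta0.
  transitivity (\prod_(0 <= i < (Zp_trunc (pdiv p)).+2) ('X - (z ^+ i)%:P)).
    by rewrite big_mkord.
  by rewrite (Fp_cast p_pr).
have := congr1 (fun P => P.[1]) prodS; rewrite /S horner_sum horner_prod.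
rewrite (eq_bigr (fun j => 1 - e j)) => [->|j _]; last by rewrite !hornerE.
rewrite (eq_bigr (fun=> 1)) => [|j _]; last by rewrite hornerXn expr1n.
by rewrite sumr_const card_ord.
Qed.

Local Notation pi1 := (1 - z).

Lemma pi1_neq0 : pi1 != 0.
Proof.
rewrite subr_eq0 eq_sym -{1}(expr1 z) -(expr0 z) (eq_prim_root_expr z_prim).
by rewrite mod0n modn_small // prime_gt1.
Qed.

Lemma sub_ezeta_pi1 j : exists2 y, cycint y & 1 - e j = pi1 * y.
Proof.
exists (\sum_(i < val j) e i%:R).
  by apply: cycint_bigsum => i _; apply: cycint_e.
rewrite -opprB {1}/e subrX1 -mulNr opprB; congr (_ * _).
by apply: eq_bigr => i _; rewrite ezeta_nat.
Qed.

(** With k inverse to j modulo p, z is the k-th power of [e j], and the cofactor is a geometric sum.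
    Together with [sub_ezeta_pi1] this makes all the 1 - e(j), j nonzero, associates, hence p an
    associate of (1 - z)^(p-1). *)
Lemma pi1_sub_ezeta j : j != 0 -> exists2 y, cycint y & pi1 = (1 - e j) * y.
Proof.
move=> j0; pose k := val j^-1.
have ek : e j ^+ k = z.
  by rewrite /e -exprM -ezeta_nat natrM -!FpE mulfV // ezeta1E.
exists (\sum_(i < k) e j ^+ i).
  by apply: cycint_bigsum => i _; apply/cycintX/cycint_e.
by rewrite -opprB -[in LHS]ek subrX1 -mulNr opprB.
Qed.

Lemma card_Fp_neq0 : #|[pred j : 'F_p | j != 0]| = p.-1.
Proof. by have := cardC1 (0 : 'F_p); rewrite card_Fp. Qed.

Lemma p_pi1 : exists2 y, cycint y & p%:R = pi1 ^+ p.-1 * y.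
Proof.
have /fin_all_exists2 [s cs sE] j := sub_ezeta_pi1 j.
exists (\prod_(j : 'F_p | j != 0) s j); first exact: cycint_prod.
rewrite -prod_sub_ezeta (eq_bigr _ (fun j _ => sE j)) big_split /=.
by rewrite prodr_const card_Fp_neq0.
Qed.

Lemma pi1_p : exists2 y, cycint y & pi1 ^+ p.-1 = p%:R * y.
Proof.
have H j : exists y, cycint y /\ (j != 0 -> pi1 = (1 - e j) * y).
  case: (eqVneq j 0) => [->|/pi1_sub_ezeta [y cy yE]]; last by exists y.
  by exists 1; split=> //; apply: (cycint_int 1).
have /fin_all_exists [s sE] := H.
exists (\prod_(j : 'F_p | j != 0) s j).
  by apply: cycint_prod => j _; case: (sE j).
rewrite -prod_sub_ezeta -big_split /= -card_Fp_neq0 -prodr_const.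
by apply: eq_bigr => j j0; case: (sE j) => _; apply.
Qed.

(** Modulo 1 - z the value P(z) becomes P(1), and p itself is a multiple of 1 - z. *)
Lemma cycint_div_pi1 P : (p %| P.[1])%Z -> exists2 y, cycint y & ev P = pi1 * y.
Proof.
move=> /dvdzP [q P1].
have /factor_theorem [Q QE] : root (P - P.[1]%:P) 1.
  by rewrite /root !hornerE subrr.
have [y cy py] := p_pi1.
have -> : P = Q * ('X - 1%:P) + P.[1]%:P by rewrite -QE subrK.
exists (- ev Q + q%:~R * (pi1 ^+ p.-2 * y)).
  apply: cycintD; first exact/cycintN/cycint_poly.
  apply: cycintM; [exact: cycint_int|apply: cycintM => //].
  apply: cycintX; apply: cycintD; first exact: (cycint_int 1).
  by apply: cycintN; rewrite -ezeta1E; apply: cycint_e.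
rewrite rmorphD rmorphM rmorphB /= !map_polyC map_polyX !hornerE P1 /=.
rewrite rmorphM /= -[(p%:~R)]/(p%:R) py rmorph1.
have -> : p.-1 = p.-2.+1 by rewrite prednK // -subn1 subn_gt0 prime_gt1.
by rewrite exprS; ring.
Qed.

Lemma conj_pi1 : pi1^* = - e (-1) * pi1.
Proof.
rewrite rmorphB rmorph1 /= -{1}ezeta1E ezeta_conj ezetaN ezeta1E.
have z0 : z != 0 by rewrite (prim_root_eq0 z_prim) -lt0n.
by field.
Qed.

(* 1 - xi is a prime associate to its conjugate, so it divides t as soon as it
   divides t t^*. *)
Lemma cycint_pi1_adic N t s : cycint t -> cycint s ->
  t * t^* = pi1 ^+ (2 * N) * s -> exists2 y, cycint y & t = pi1 ^+ N * y.
Proof.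
elim: N t s => [|N IHN] t s ct cs tt.
  by exists t => //; rewrite mul1r.
have [P tP] := ct; have [S sS] := cs.
pose D := P * (P \Po 'X^(p.-1)) - (1 - 'X) ^+ (2 * N.+1) * S.
have D0 : ev D = 0.
  rewrite /D rmorphB rmorphM rmorphM rmorphXn rmorphB rmorph1 /= map_polyX.
  rewrite hornerD hornerN !hornerM -conj_poly -tP -sS tt horner_exp !hornerE.
  by rewrite subrr.
have dP : (p %| P.[1])%Z.
  have := aug_wd D0; rewrite /D !hornerE ?horner_exp ?horner_comp ?hornerXn.
  rewrite subrr expr1n expr0n mul0r subr0 dvdzE abszM.
  by rewrite /= Euclid_dvdM // orbb.
have [y cy ty] := cycint_div_pi1 dP; rewrite -tP in ty.
have [x cx yx] : exists2 x, cycint x & y = pi1 ^+ N * x.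
  apply: (IHN y (- e 1 * s)) => //.
    by apply: cycintM => //; apply/cycintN/cycint_e.
  have pi20 : pi1 * pi1 != 0 by rewrite mulf_neq0 ?pi1_neq0.
  apply: (mulfI pi20); have := ezeta_neq0 1 => e10.
  move: tt; rewrite ty rmorphM /= conj_pi1 mulnS exprD expr2 ezetaN => tt.
  transitivity (- e 1 * (pi1 * y * (- (e 1)^-1 * pi1 * y^*))); first by field.
  by rewrite tt; ring.
by exists x; rewrite // ty yx mulrA -exprS.
Qed.

(** The product t t^* contains 1 - z to the power 2(p-1)k; half of it goes to t, and (1 -
    z)^((p-1)k) is divisible by p^k. *)
Lemma cycint_div_p k t : cycint t -> t * t^* = p%:R ^+ (2 * k) ->
  exists2 u, cycint u & t = p%:R ^+ k * u.
Proof.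
move=> ct tt.
have [v cv pv] := p_pi1; have [w cw wp] := pi1_p.
have [y cy ->] : exists2 y, cycint y & t = pi1 ^+ (p.-1 * k) * y.
  apply: (@cycint_pi1_adic _ _ (v ^+ (2 * k))) => //; first exact: cycintX.
  by rewrite tt pv exprMn -exprM mulnCA.
exists (w ^+ k * y); first by apply: cycintM => //; apply: cycintX.
by rewrite exprM wp exprMn mulrA.
Qed.

Lemma ezeta_normsq (a : 'F_p -> int) c :
  (\sum_i (a i)%:~R * e (c * i)) * (\sum_i (a i)%:~R * e (c * i))^*
  = \sum_(ij : 'F_p * 'F_p) (a ij.1 * a ij.2)%:~R * e (c * (ij.1 - ij.2)).
Proof.
rewrite -(pair_bigA _ (fun i j => (a i * a j)%:~R * e (c * (i - j)))) /=.
rewrite rmorph_sum mulr_suml; apply: eq_bigr => i _.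
rewrite mulr_sumr; apply: eq_bigr => j _ /=.
by rewrite rmorphM rmorph_int /= ezeta_conj mulrBr ezetaD rmorphM /= mulrACA.
Qed.

Lemma ezeta_parseval (a : 'F_p -> int) :
  \sum_c (\sum_i (a i)%:~R * e (c * i)) * (\sum_i (a i)%:~R * e (c * i))^*
  = p%:R * (\sum_i a i ^+ 2)%:~R.
Proof.
under eq_bigr do rewrite ezeta_normsq.
rewrite exchange_big /=.
rewrite -(pair_bigA _ (fun i j => \sum_c (a i * a j)%:~R * e (c * (i - j)))) /=.
rewrite rmorph_sum mulr_sumr; apply: eq_bigr => i _ /=.
rewrite (bigD1 i) //= -mulr_sumr ezeta_sum subrr eqxx big1 => [|j ij].
  by rewrite addr0 expr2 mulrC.
by rewrite -mulr_sumr ezeta_sum subr_eq0 eq_sym (negPf ij) mulr0.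
Qed.

Lemma int_sum_sqr_eq1 (I : finType) (b : I -> int) : \sum_i b i ^+ 2 = 1 ->
  exists s : bool, exists j, forall i, b i = (i == j)%:R * (-1) ^+ s.
Proof.
move=> b1.
have [j bj] : exists j, b j != 0.
  apply/existsP; apply: contraT; rewrite negb_exists => /forallP h.
  by move: b1; rewrite big1 // => i _; move: (h i); rewrite negbK => /eqP ->.
move: b1; rewrite (bigD1 j) //= => b1.
have ge1 : 1 <= b j ^+ 2 by nia.
have ge0 : 0 <= \sum_(i | i != j) b i ^+ 2 by apply: sumr_ge0 => i _; apply: sqr_ge0.
have s0 : \sum_(i | i != j) b i ^+ 2 = 0 by lra.
have bj1 : b j ^+ 2 = 1 by lra.
exists (b j < 0), j => i; case: eqP => [->|/eqP ij].
  by rewrite mul1r; case: ltP => h; rewrite ?expr0 ?expr1; nia.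
rewrite mul0r; apply/eqP; rewrite -sqrf_eq0; apply/eqP.
by apply: (psumr_eq0P _ s0) => // k _; apply: sqr_ge0.
Qed.

(* Averaging |sum_j a_j xi^(c j)|^2 over c gives p sum a_j^2 = (sum a_j)^2 + p - 1.
   Hence sum a_j is +-1 modulo p, and after subtracting a constant from all the a_j
   it is +-1, so that sum a_j^2 = 1. *)
Lemma cycint_norm1 u : cycint u -> u * u^* = 1 ->
  exists s : bool, exists j, u = (-1) ^+ s * e j.
Proof.
move=> /cycintP [a uE] uu.
pose A := \sum_i a i.
have norm (c : 'F_p) : c != 0 ->
    (\sum_i (a i)%:~R * e (c * i)) * (\sum_i (a i)%:~R * e (c * i))^* = 1.
  move=> c0.

  (* Written as a relation between powers of z, the equation u u^* = 1 passes to every conjugate of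
     u by [ezeta_galois]. *)
  have h : \sum_(ij : 'F_p * 'F_p) (a ij.1 * a ij.2)%:~R * e (ij.1 - ij.2)
      = \sum_(i < 1) 1%:~R * e 0.
    rewrite big_ord1 ezeta0 mulr1 -[RHS]uu uE.
    have := ezeta_normsq a 1; under eq_bigr do rewrite mul1r.
    by move=> ->; apply: eq_bigr => i _; rewrite mul1r.
  rewrite ezeta_normsq (ezeta_galois c0 h) big_ord1 mulr0 ezeta0.
  by rewrite mulr1.
have pA : p%:Z * (\sum_i a i ^+ 2) = A ^+ 2 + p.-1%:Z.
  apply: (@intr_inj C); rewrite rmorphM /= -[(p%:Z)%:~R]/(p%:R).
  rewrite -ezeta_parseval (bigD1 0) //=.
  rewrite [X in _ + X](eq_bigr (fun=> 1)) => [|c c0]; last exact: norm.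
  rewrite sumr_const card_Fp_neq0 rmorphD; congr (_ + _).
  rewrite (eq_bigr (fun i => (a i)%:~R)) => [|i _]; last by rewrite mul0r ezeta0 mulr1.
  by rewrite -rmorph_sum rmorph_int expr2 rmorphM.
have pP : (p.-1%:Z = p%:Z - 1)%R by rewrite -[in RHS](prednK p_gt0) -natz; lia.
have [d [m [dE Am]]] : exists d m : int, d ^+ 2 = 1 /\ A = d + p%:Z * m.
  have : (p%:Z %| (A - 1) * (A + 1))%Z.
    apply/dvdzP; exists (\sum_i a i ^+ 2 - 1).
    transitivity (p%:Z * (\sum_i a i ^+ 2) - p%:Z); last by ring.
    by rewrite pA pP; ring.
  rewrite dvdzE abszM Euclid_dvdM // => /orP [] /dvdzP [m mE].
    by exists 1, m; split=> //; rewrite mulrC -mE; ring.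
  by exists (-1), m; split=> //; rewrite mulrC -mE; ring.
pose b j := a j - m.
have sumb : \sum_i b i = d.
  by rewrite sumrB sumr_const card_Fp // -/A Am -mulr_natr natz; ring.
have : \sum_i b i ^+ 2 = 1.
  have p0 : p%:Z != 0 by rewrite -lt0n.
  apply: (mulfI p0); rewrite mulr1.
  have -> : \sum_i b i ^+ 2 = \sum_i a i ^+ 2 - 2 * m * A + p%:Z * m ^+ 2.
    rewrite (eq_bigr (fun i => a i ^+ 2 - 2 * m * a i + m ^+ 2)) => [|i _].
      rewrite big_split sumrB -mulr_sumr sumr_const card_Fp // -/A.
      by rewrite /= -[m ^+ 2 *+ p]mulr_natr natz; ring.
    by rewrite /b; ring.
  rewrite mulrDr mulrBr pA pP Am.
  by transitivity (d ^+ 2 + p%:Z - 1); [ring|rewrite dE; ring].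
case/int_sum_sqr_eq1 => s [j bE]; exists s, j.
have -> : u = \sum_i (b i)%:~R * e i.
  rewrite uE; under [RHS]eq_bigr do rewrite rmorphB mulrBl.
  by rewrite sumrB -mulr_sumr ezeta_sum0 mulr0 subr0.
rewrite (bigD1 j) //= big1 => [|i ij].
  by rewrite bE eqxx mul1r addr0 rmorphXn rmorphN rmorph1.
by rewrite bE (negPf ij) !mul0r.
Qed.

Lemma cycint_norm_Xp k t : cycint t -> t * t^* = p%:R ^+ (2 * k) ->
  exists s : bool, exists j, t = (-1) ^+ s * p%:R ^+ k * e j.
Proof.
move=> ct tt; have [u cu tE] := cycint_div_p ct tt.
have pn0 : (p%:R : C) ^+ (2 * k) != 0 by rewrite expf_neq0 // pnatr_eq0 -lt0n.
have [|s [j uE]] := cycint_norm1 cu.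
  apply: (mulfI pn0); rewrite mulr1 -[RHS]tt tE rmorphM rmorphXn rmorph_nat /=.
  by rewrite mul2n -addnn exprD; ring.
by exists s, j; rewrite tE uE; ring.
Qed.

(** * The quadratic Gauss sum and congruences modulo 2 *)

Hypothesis p_odd : odd p.

Local Notation eta := (@legendre p).

(** Multiplication by a primitive root, which is a nonsquare, changes the sign of the sum. *)
Lemma legendre_sum0 : \sum_(a : 'F_p) eta a = 0.
Proof.
have [g gP] := Fp_prim_root p_pr.
have p1 : (0 < p./2)%N by rewrite -double_gt0 -p_half // -subn1 subn_gt0 prime_gt1.
have g0 : g != 0 by rewrite (prim_root_eq0 gP) -lt0n p_half // double_gt0.
have eg : eta g = -1.
  rewrite /legendre (negPf g0) euler_criterion // -(prim_order_dvd gP) p_half //.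
  by rewrite gtnNdvd // -addnn -{1}(add0n p./2) ltn_add2r.
have : \sum_a eta a = - \sum_a eta a.
  rewrite {1}(reindex_inj (mulfI g0)) -sumrN; apply: eq_bigr => a _ /=.
  by rewrite legendreM // eg mulN1r.
by move/esym/eqP; rewrite eqNr => /eqP.
Qed.

Definition gauss : C := \sum_j (eta j)%:~R * e j.

Lemma gauss_galois c : c != 0 ->
  \sum_j (eta j)%:~R * e (c * j) = (eta c)%:~R * gauss.
Proof.
move=> c0; rewrite /gauss mulr_sumr [RHS](reindex_inj (mulfI c0)) /=.
apply: eq_bigr => j _; rewrite mulrA -rmorphM -legendreM //= mulrA -expr2.
by rewrite [in RHS]legendreM // [in RHS]legendreX // legendre_sqr // mul1r.
Qed.

Lemma legendreN1_neq0 : (-1 : 'F_p) != 0. Proof. by rewrite oppr_eq0 oner_eq0. Qed.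

Lemma gauss_conj : gauss^* = (eta (-1))%:~R * gauss.
Proof.
rewrite -gauss_galois ?legendreN1_neq0 // rmorph_sum; apply: eq_bigr => j _ /=.
by rewrite rmorphM rmorph_int /= ezeta_conj mulN1r.
Qed.

(** Parseval for the coefficients eta: c = 0 contributes 0, each of the other p - 1 values of c
    contributes the left side, and the total is p(p - 1). *)
Lemma gauss_norm : gauss * gauss^* = p%:R.
Proof.
have := ezeta_parseval eta; rewrite (bigD1 0) //=.
rewrite [X in X * _ + _](_ : _ = 0); last first.
  rewrite (eq_bigr (fun i => (eta i)%:~R)) => [|i _]; last by rewrite mul0r ezeta0 mulr1.
  by rewrite -rmorph_sum legendre_sum0.
rewrite mul0r add0r (eq_bigr (fun=> gauss * gauss^*)) => [|c c0]; last first.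
  rewrite gauss_galois // rmorphM rmorph_int mulrACA -rmorphM -expr2.
  by rewrite legendre_sqr // mul1r.
have -> : \sum_i eta i ^+ 2 = p.-1%:Z.
  rewrite (bigD1 0) //= legendre0 expr0n add0r (eq_bigr (fun=> 1)) => [|c c0].
    by rewrite sumr_const card_Fp_neq0 natz.
  exact: legendre_sqr.
rewrite sumr_const card_Fp_neq0 -[X in X = _ -> _]mulr_natr -[(p.-1%:Z)%:~R]/(p.-1%:R : C).
apply: mulIf.
by rewrite pnatr_eq0 -lt0n -subn1 subn_gt0 prime_gt1.
Qed.

Lemma gauss_sqr : gauss ^+ 2 = (-1) ^+ p./2 * p%:R.
Proof.
rewrite -gauss_norm gauss_conj legendreN1 // rmorphXn rmorphN1 /=.
transitivity (((-1) ^+ p./2) ^+ 2 * gauss ^+ 2); [by rewrite sqrr_sign mul1r|ring].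
Qed.

Lemma prod_Fp_neq0 (M : comNzRingType) (F : 'F_p -> M) :
  \prod_(j : 'F_p | j != 0) F j = \prod_(1 <= k < p) F k%:R.
Proof.
transitivity (\prod_(0 <= k < (Zp_trunc (pdiv p)).+2 | k != 0%N) F k%:R).
  rewrite big_mkord; apply: eq_big => [j|j _]; last by rewrite {1}(FpE j).
  by rewrite -(inj_eq val_inj).
rewrite (Fp_cast p_pr) big_mkcond big_ltn //= mul1r big_nat_cond [RHS]big_nat_cond.
rewrite -big_mkcondr /=; apply: eq_bigl => k; rewrite andbT -andbA.
by case: k => [|k] /=; rewrite ?andbT.
Qed.

Lemma prod_half (M : comNzRingType) (F : 'F_p -> M) :
  \prod_(j : 'F_p | j != 0) F j = \prod_(1 <= k < p./2.+1) (F k%:R * F (- k%:R)).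
Proof.
rewrite prod_Fp_neq0.
have pE : p = (p./2 + p./2.+1)%N by rewrite addnS addnn -p_half // prednK.
rewrite (big_cat_nat (n := p./2.+1)) //=; last by rewrite {2}pE leq_addl.
rewrite big_split /=; congr (_ * _).
rewrite big_nat_rev /= -[p./2.+1 in LHS]add1n big_addn.
have -> : (p - p./2 = p./2.+1)%N by rewrite {1}pE addKn.
apply: eq_big_nat => k /andP [k1 kp].
congr F; apply/eqP; rewrite -subr_eq0 opprK -natrD.
rewrite (_ : (_ + k)%N = p); first by rewrite pchar_Fp_0.
by lia.
Qed.

Lemma Fp_sum_poly (q : {poly 'F_p}) : (size q <= p.-1)%N -> \sum_a q.[a] = 0.
Proof.
move=> sq; under eq_bigr do rewrite horner_coef.
rewrite exchange_big big1 // => i _ /=.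
by rewrite -mulr_sumr Fp_sum_expr ?mulr0 //; apply: leq_trans (ltn_ord i) sq.
Qed.

(* Relations between the powers of xi are the multiples of sum_j xi^j, and a power sum
   over F_p of degree < p - 1 vanishes. *)
Lemma ezeta_moment (a b : 'F_p -> int) (q : {poly 'F_p}) : (size q <= p.-1)%N ->
  \sum_j (a j)%:~R * e j = \sum_j (b j)%:~R * e j ->
  \sum_j (a j)%:~R * q.[j] = \sum_j (b j)%:~R * q.[j].
Proof.
move=> sq ab; apply/eqP; rewrite -subr_eq0 -sumrB.
have d0 : \sum_j (a j - b j)%:~R * e j = 0.
  by under eq_bigr do rewrite rmorphB mulrBl; rewrite sumrB ab subrr.
have dc := ezeta_free d0.
rewrite (eq_bigr (fun j => (a 0 - b 0)%:~R * q.[j])) => [|j _].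
  by rewrite -mulr_sumr Fp_sum_poly ?mulr0.
by rewrite -(dc j) rmorphB mulrBl.
Qed.

(* Coefficients in the group ring of the product of the e(a) - e(b), (a, b) in s. *)
Fixpoint prod_coefs (s : seq ('F_p * 'F_p)) (j : 'F_p) : int :=
  if s is ab :: s' then prod_coefs s' (j - ab.1) - prod_coefs s' (j - ab.2)
  else (j == 0)%:R.

Lemma prod_coefs_shift (M : comNzRingType) s (F : 'F_p -> M) ab :
  \sum_j (prod_coefs (ab :: s) j)%:~R * F j =
  \sum_j (prod_coefs s j)%:~R * (F (j + ab.1) - F (j + ab.2)).
Proof.
under [LHS]eq_bigr do rewrite /= rmorphB mulrBl.
under [RHS]eq_bigr do rewrite mulrBr.
rewrite !sumrB; congr (_ - _).
  by rewrite (reindex_inj (addIr ab.1)); apply: eq_bigr => j _; rewrite addrK.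
by rewrite (reindex_inj (addIr ab.2)); apply: eq_bigr => j _; rewrite addrK.
Qed.

Lemma prod_coefsE s :
  \sum_j (prod_coefs s j)%:~R * e j = \prod_(ab <- s) (e ab.1 - e ab.2).
Proof.
elim: s => [|ab s IH].
  rewrite big_nil (bigD1 0) //= ezeta0 big1 => [|j /negPf ->]; last by rewrite mul0r.
  by rewrite mul1r addr0.
rewrite prod_coefs_shift big_cons -IH mulr_sumr; apply: eq_bigr => j _.
by rewrite !ezetaD; ring.
Qed.

(** A difference of two translates loses one degree: the top terms cancel, and the next coefficient
    comes from the linear terms of (X + a)^(d+1) and (X + b)^(d+1). *)
Lemma size_coef_comp_XaddC (q : {poly 'F_p}) d a b : (size q <= d.+2)%N ->
  let r := (q \Po ('X + a%:P)) - (q \Po ('X + b%:P)) in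
  (size r <= d.+1)%N /\ r`_d = q`_d.+1 * d.+1%:R * (a - b).
Proof.
move=> sq r.
have E c i : (q \Po ('X + c%:P))`_i =
    \sum_(k < d.+2) q`_k * ((c ^+ (k - i)) *+ 'C(k, i)).
  rewrite coef_comp_poly (big_ord_widen d.+2 (fun k => q`_k * (('X + c%:P) ^+ k)`_i)) //.
  rewrite big_mkcond; apply: eq_bigr => k _; case: ltnP => [_|sk]; last first.
    by rewrite nth_default // mul0r.
  congr (_ * _); rewrite addrC exprDn coef_sum.
  case: (ltnP k i) => ki.
    rewrite bin_small // mulr0n big1 // => l _.
    rewrite coefMn -polyC_exp coefCM coefXn gtn_eqF ?mulr0 ?mul0rn //.
    by apply: leq_ltn_trans ki; rewrite -ltnS.
  rewrite (bigD1 (Ordinal (ki : (i < k.+1)%N))) //= big1 => [|l li].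
    by rewrite addr0 coefMn -polyC_exp coefCM coefXn eqxx mulr1.
  rewrite coefMn -polyC_exp coefCM coefXn (_ : (i == l) = false) ?mulr0 ?mul0rn //.
  by apply: contraNF li => /eqP il; apply/eqP/val_inj.
split.
  apply/leq_sizeP => i di; rewrite /r coefB !E -sumrB big1 // => k _.
  case: (eqVneq (k : nat) i) => [->|ki]; first by rewrite subnn subrr.
  have ki' : (k < i)%N by rewrite ltn_neqAle ki (leq_trans _ di) // -ltnS.
  by rewrite bin_small // !mulr0n subrr.
rewrite /r coefB !E -sumrB big_ord_recr big_ord_recr /= big1 ?add0r => [|k _].
  by rewrite subnn subrr add0r subSnn binSn !expr1 -[a *+ _]mulr_natr -[b *+ _]mulr_natr; ring.
by rewrite bin_small // !mulr0n subrr.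
Qed.

(* The moment of a product of d differences is an iterated difference of order d. *)
Lemma prod_coefs_moment s (q : {poly 'F_p}) : (size q <= (size s).+1)%N ->
  \sum_j (prod_coefs s j)%:~R * q.[j] =
  q`_(size s) * (size s)`!%:R * \prod_(ab <- s) (ab.1 - ab.2).
Proof.
elim: s q => [|ab s IH] q sq.
  rewrite big_nil !mulr1 (bigD1 0) //= mul1r big1 => [|j /negPf ->]; last by rewrite mul0r.
  by rewrite addr0 horner_coef0.
have [sr rd] := size_coef_comp_XaddC ab.1 ab.2 sq.
rewrite prod_coefs_shift; have := IH _ sr; rewrite rd => IHr.
rewrite big_cons /= factS natrM.
transitivity (q`_(size s).+1 * (size s).+1%:R * (ab.1 - ab.2) * (size s)`!%:R *
    \prod_(j <- s) (j.1 - j.2)); last by ring.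
rewrite -IHr; apply: eq_bigr => j _.
by rewrite hornerD hornerN !horner_comp !hornerE.
Qed.

(** Gauss's half-product. Halving in F_p makes each factor, for z = xi, equal to (-1)^k 2i sin(pi k
    / p), so that its argument is visible. *)
Definition gauss_prod : C :=
  \prod_(1 <= k < p./2.+1) (e (k%:R / 2%:R) - e (- (k%:R / 2%:R))).

(** In p = prod (1 - e(j)) the factors for k and -k multiply to -(e(k/2) - e(-k/2))^2. *)
Lemma gauss_prod_sqr : gauss_prod ^+ 2 = (-1) ^+ p./2 * p%:R.
Proof.
have -> : (-1) ^+ p./2 = \prod_(1 <= k < p./2.+1) (-1 : C).
  by rewrite prodr_const_nat subSS subn0.
rewrite -prod_sub_ezeta prod_half -big_split /= expr2 /gauss_prod -big_split /=.
apply: eq_bigr => k _; have h2 := Fp_two_neq0 p_pr p_odd.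
have eh : e k%:R = e (k%:R / 2%:R) ^+ 2.
  by rewrite expr2 -ezetaD -mulrDl -mulr2n -[_ *+ 2]mulr_natr mulfK.
rewrite !ezetaN eh; have := ezeta_neq0 (k%:R / 2%:R) => e0.
by field.
Qed.

(** Wilson's theorem with the factors k and -k grouped together. *)
Lemma half_fact_sqr : ((p./2)`!%:R) ^+ 2 = - (-1) ^+ p./2 :> 'F_p.
Proof.
have F1 : \prod_(1 <= k < p) (k%:R : 'F_p) = -1.
  have := Wilson (prime_gt1 p_pr); rewrite p_pr => /esym.
  rewrite (dvdn_pcharf (pchar_Fp p_pr)) -natr1 addr_eq0 => /eqP <-.
  by rewrite fact_prod prednK // natr_prod.
rewrite fact_prod natr_prod -prodrXl.
have := prod_half (fun x : 'F_p => x); rewrite prod_Fp_neq0 F1.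
rewrite (eq_bigr (fun k : nat => -1 * k%:R ^+ 2)) => [|k _]; last by ring.
rewrite big_split /= prodr_const_nat subSS subn0 => h.
by rewrite -[LHS](signrMK p./2) -h mulrN1.
Qed.

(* Both sides have the same square; the moments of order (p - 1)/2 fix the sign. *)
Lemma gauss_prodE : gauss = (-1) ^+ p./2 * gauss_prod.
Proof.
pose s := [seq (k%:R / 2%:R, - (k%:R / 2%:R)) : 'F_p * 'F_p | k <- index_iota 1 p./2.+1].
have ss : size s = p./2 by rewrite size_map size_iota subSS subn0.
have sE : \sum_j (prod_coefs s j)%:~R * e j = gauss_prod.
  by rewrite prod_coefsE big_map.
have h2 := Fp_two_neq0 p_pr p_odd.
have sM : \sum_j (prod_coefs s j)%:~R * ('X^(p./2)).[j] = - (-1) ^+ p./2 :> 'F_p.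
  rewrite prod_coefs_moment ?size_polyXn ss // coefXn eqxx mul1r -half_fact_sqr expr2.
  congr (_ * _); rewrite big_map fact_prod natr_prod; apply: eq_bigr => k _ /=.
  by rewrite opprK -mulrDl -mulr2n -[_ *+ 2]mulr_natr mulfK.
(* In F_p, eta(j) is j^((p-1)/2), so this moment is the sum of the (p-1)-th powers. *)
have gM : \sum_j (eta j)%:~R * ('X^(p./2)).[j] = -1 :> 'F_p.
  rewrite -Fp_sum_exprp1 //; apply: eq_bigr => j _.
  by rewrite legendreE // hornerXn -exprD addnn -p_half.
have sz : (size ('X^(p./2) : {poly 'F_p}) <= p.-1)%N.
  have := prime_gt1 p_pr; have := p_half p_odd; rewrite size_polyXn -addnn; lia.
have : gauss ^+ 2 == gauss_prod ^+ 2 by rewrite gauss_sqr gauss_prod_sqr.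
rewrite eqf_sqr => /orP gE.
have hm := Fp_m1_neq1 p_pr p_odd.
have gE' (d : bool) : gauss = (-1) ^+ d * gauss_prod ->
    -1 = (-1) ^+ d * (- (-1) ^+ p./2) :> 'F_p.
  rewrite -sE => h; rewrite -[LHS]gM -sM mulr_sumr.
  have := @ezeta_moment eta (fun j => (-1) ^+ d * prod_coefs s j) _ sz.
  move=> ->; last first.
    rewrite -[LHS]/gauss h mulr_sumr; apply: eq_bigr => j _.
    by rewrite rmorphM rmorphXn rmorphN1 mulrA.
  by apply: eq_bigr => j _; rewrite rmorphM rmorphXn rmorphN1 mulrA.
have : exists d : bool, gauss = (-1) ^+ d * gauss_prod.
  case: gE => /eqP ->; first by exists false; rewrite mul1r.
  by exists true; rewrite expr1 mulN1r.
case=> d h; rewrite h; congr (_ * _).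
move/eqP: (gE' d h); rewrite mulrN eqr_opp -(signr_odd _ p./2) -[RHS]signr_odd.
case: d {h}; case: (odd _); rewrite ?expr0 ?expr1 ?mulr1 ?mul1r //.
  by rewrite eq_sym (negPf hm).
by rewrite eq_sym (negPf hm).
Qed.

Lemma Fp_avoid2 (a b : 'F_p) : exists2 k : 'F_p, k != a & k != b.
Proof.
have : ~~ ([set: 'F_p] \subset [set a; b]).
  apply/negP => /subset_leq_card; rewrite cardsT card_Fp // cards2.
  by move=> p2; have := leq_trans (odd_prime_gt2 p_odd p_pr) p2; case: (_ != _).
by case/subsetPn => k _; rewrite !inE negb_or => /andP [ka kb]; exists k.
Qed.

Lemma intr_sign (s : bool) : ((-1) ^+ s : int)%:~R = (-1) ^+ s :> C.
Proof. by rewrite rmorphXn rmorphN1. Qed.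

Lemma ezeta_delta (k : 'F_p) : \sum_j ((j == k)%:R : int)%:~R * e j = e k.
Proof.
rewrite (bigD1 k) //= eqxx mul1r big1 ?addr0 // => j /negPf ->.
by rewrite mul0r.
Qed.

(** By [ezeta_free] all coefficients of the relation are equal. If [a] and [b] differed, the one at
    [a] would be odd, and the one at a third index, available since p > 2, even. *)
Lemma ezeta_mod2 y (s1 s2 : bool) N a b : odd N -> cycint y ->
  2%:R * y = N%:R * ((-1) ^+ s1 * e a + (-1) ^+ s2 * e b) -> a = b.
Proof.
move=> oN /cycintP [c ->] h; apply/eqP; apply: contraT => ab.
pose w j : int :=
  2 * c j - N%:Z * ((-1) ^+ s1 * (j == a)%:R + (-1) ^+ s2 * (j == b)%:R).
have w0 : \sum_j (w j)%:~R * e j = 0.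
  transitivity (2%:R * (\sum_j (c j)%:~R * e j) -
      N%:R * ((-1) ^+ s1 * \sum_j ((j == a)%:R : int)%:~R * e j +
              (-1) ^+ s2 * \sum_j ((j == b)%:R : int)%:~R * e j)).
    rewrite !mulr_sumr -big_split mulr_sumr -sumrB; apply: eq_bigr => j _ /=.
    rewrite /w intrB !intrM !intrD !intrM !intr_sign -[(N%:Z)%:~R]/(N%:R : C).
    by rewrite -[1%:~R]/(1 : C); ring.
  by rewrite !ezeta_delta h subrr.
have [k /negPf ka /negPf kb] := Fp_avoid2 a b.
have := ezeta_free w0 k a; rewrite /w ka kb eqxx (negPf ab) !mulr0 addr0 mulr1.
have := odd_double_half N; rewrite oN -addnn.
by case: (s1); rewrite ?expr0 ?expr1; lia.
Qed.

Lemma cycint_gauss : cycint gauss.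
Proof. exact: (@cycint_sum _ eta id). Qed.

(** Modulo 2, G has coefficient 0 at 0 and 1 elsewhere. If [j] were nonzero, the coefficient of the
    relation at 0 would be even and the one at an index other than 0 and [j] odd. *)
Lemma gauss_mod2 y (s : bool) N1 N2 j : odd N1 -> cycint y ->
  N1%:R * gauss * (1 + 2%:R * y) = (-1) ^+ s * N2%:R * e j -> j = 0.
Proof.
move=> oN cy; rewrite mulrDr mulr1.
have : cycint (N1%:R * gauss * y).
  by apply: cycintM => //; apply: cycintM; [exact: (cycint_int N1)|exact: cycint_gauss].
rewrite [_ * (2%:R * y)]mulrCA => /cycintP [c ->] h.
apply/eqP; apply: contraT => j0.
pose w i : int := N1%:Z * eta i + 2 * c i - (-1) ^+ s * N2%:Z * (i == j)%:R.
have w0 : \sum_i (w i)%:~R * e i = 0.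
  transitivity (N1%:R * gauss + 2%:R * (\sum_j (c j)%:~R * e j) -
      (-1) ^+ s * N2%:R * \sum_i ((i == j)%:R : int)%:~R * e i).
    rewrite /gauss !mulr_sumr -big_split -sumrB; apply: eq_bigr => i _ /=.
    rewrite /w intrB !intrD !intrM !intr_sign !intrD -[(N1%:Z)%:~R]/(N1%:R : C).
    by rewrite -[(N2%:Z)%:~R]/(N2%:R : C) -[1%:~R]/(1 : C); ring.
  by rewrite h ezeta_delta subrr.
have [k k0 /negPf kj] := Fp_avoid2 0 j.
have := ezeta_free w0 k 0; rewrite /w kj eq_sym (negPf j0) legendre0 !mulr0 !subr0 add0r.
have := legendre_sqr k0; have := odd_double_half N1; rewrite oN -addnn.
by case: (legendre_cases k) => ->; rewrite ?expr0n //; lia.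
Qed.

End CyclotomicIntegers.
(** * The sign of the quadratic Gauss sum *)

Section ComplexRoots.

Variables (R : realType) (p : nat).
Hypotheses (p_pr : prime p) (p_odd : odd p).

Local Notation cis t := (Complex (cos t) (sin t)).

Let p_gt2 : (2 < p)%N := odd_prime_gt2 p_odd p_pr.

Let pR : (p%:R : R) != 0. Proof. by rewrite pnatr_eq0 -lt0n prime_gt0. Qed.

Lemma cisD (s t : R) : cis (s + t) = cis s * cis t.
Proof. by rewrite cosD sinD; congr Complex; ring. Qed.

Lemma cis_exp (t : R) k : cis t ^+ k = cis (t *+ k).
Proof.
elim: k => [|k IH]; first by rewrite mulr0n cos0 sin0.
by rewrite exprS IH mulrS cisD.
Qed.

Lemma cisN (t : R) : cis (- t) = (cis t)^-1.
Proof.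
have t0 : cis t != 0.
  apply/eqP => t0; have := cisD t (- t); rewrite t0 mul0r subrr cos0 sin0 => /eqP.
  by rewrite eq_complex /= oner_eq0.
by apply: (mulfI t0); rewrite -cisD subrr cos0 sin0 mulfV.
Qed.

Lemma xiE : xi R p = cis (pi / p%:R) ^+ 2.
Proof. by rewrite cis_exp /xi -mulrnAl. Qed.

Lemma cis_half_p : cis (pi / p%:R : R) ^+ p = -1.
Proof.
rewrite cis_exp -[_ *+ p]mulr_natr divfK // cospi sinpi.
by apply/eqP; rewrite eq_complex /= oppr0 !eqxx.
Qed.

Lemma sin_pi_frac k : (0 < k < p)%N -> 0 < sin (pi / p%:R *+ k : R).
Proof.
move=> /andP [k0 kp]; apply: sin_gt0_pi; have := pi_gt0 R => pi0.
have p0 : 0 < p%:R :> R by rewrite ltr0n prime_gt0.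
have -> /= : 0 < pi / p%:R *+ k :> R by rewrite pmulrn_lgt0 // divr_gt0.
rewrite -[_ *+ k]mulr_natr.
by rewrite mulrAC ltr_pdivrMr // ltr_pM2l // ltr_nat.
Qed.

Lemma xi_prim : p.-primitive_root (xi R p).
Proof.
have xip : xi R p ^+ p = 1 by rewrite xiE -exprM mulnC exprM cis_half_p sqrrN expr1n.
have [m mP] := prim_order_exists (prime_gt0 p_pr) xip.
(* The order divides p, and it is not 1 because sin(2 pi / p) > 0. *)
case/(primeP p_pr).2/orP => /eqP mE; last by move: mP; rewrite {1}mE.
have := prim_expr_order mP; rewrite mE expr1 xiE cis_exp => /eqP.
rewrite eq_complex /= => /andP [_]; by rewrite gt_eqF // sin_pi_frac.
Qed.

Local Notation e := (@ezeta p _ (xi R p)).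

(** In F_p, k/2 is k(p + 1)/2, and xi is the square of cis(pi/p), whose p-th power is -1; this is
    the origin of the sign. *)
Lemma ezeta_half k : e (k%:R / 2%:R) = (-1) ^+ k * cis (pi / p%:R *+ k).
Proof.
have -> : (k%:R / 2%:R : 'F_p) = (k * p.+1./2)%:R.
  have h2 := Fp_two_neq0 p_pr p_odd.
  apply: (mulIf h2); rewrite divfK // -natrM -mulnA muln2.
  have -> : (p.+1./2).*2 = p.+1 by rewrite -[RHS]odd_double_half /= p_odd.
  by rewrite natrM -natr1 pchar_Fp_0 // add0r mulr1.
rewrite ezeta_nat // ?xi_prim // xiE -exprM mulnCA mul2n.
have -> : (p.+1./2).*2 = p.+1 by rewrite -[RHS]odd_double_half /= p_odd.
by rewrite mulnS exprD mulnC exprM cis_half_p cis_exp mulrC.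
Qed.

Lemma gauss_prod_sin : gauss_prod p (xi R p) =
  (-1) ^+ 'C((p./2).+1, 2) * 'i%C ^+ p./2 *
  (\prod_(1 <= k < p./2.+1) (2%:R * sin (pi / p%:R *+ k)))%:C%C.
Proof.
have -> : (-1) ^+ 'C((p./2).+1, 2) = \prod_(1 <= k < p./2.+1) (-1) ^+ k :> R[i].
  by rewrite -bin2_sum big_ltn // add0n -prodrXr.
have -> : 'i%C ^+ p./2 = \prod_(1 <= k < p./2.+1) 'i%C :> R[i].
  by rewrite prodr_const_nat subSS subn0.
rewrite rmorph_prod -!big_split; apply: eq_bigr => k _ /=.
rewrite (ezetaN p_pr xi_prim) ezeta_half invfM invr_sign -cisN -mulrBr -mulrA.
congr (_ * _); apply/eqP; rewrite eq_complex /= cosN sinN.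
by apply/andP; split; apply/eqP; ring.
Qed.

(** The product of sines is positive with square p, so it is sqrt p. With m = (p - 1)/2 the
    remaining factor (-1)^m (-1)^(m(m+1)/2) i^m is 1 for m even and i for m odd. *)
Lemma gauss_value : gauss p (xi R p) =
  (if (p %% 4 == 1)%N then 1 else 'i%C) * (Num.sqrt p%:R)%:C%C.
Proof.
pose P : R := \prod_(1 <= k < p./2.+1) (2%:R * sin (pi / p%:R *+ k)).
have P0 : 0 < P.
  rewrite /P big_nat_cond; apply: prodr_gt0 => k /andP [/andP [k1 kp] _].
  rewrite mulr_gt0 ?ltr0n // sin_pi_frac // k1 (leq_trans kp) //.
  have := p_half p_odd; have := p_gt2; lia.
have PE : P = Num.sqrt p%:R.
  have := gauss_prod_sqr p_pr xi_prim p_odd; rewrite gauss_prod_sin -/P.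
  rewrite !exprMn sqrr_sign mul1r exprAC sqr_i => /(mulfI _) h.
  rewrite -[LHS](gtr0_norm P0) -sqrtr_sqr; congr Num.sqrt; apply: complexI.
  by rewrite rmorphXn /= h ?rmorph_nat // signr_eq0.
rewrite (gauss_prodE p_pr xi_prim p_odd) gauss_prod_sin -/P PE mulrA; congr (_ * _).
have pE : p = ((p./2).*2).+1 by rewrite -{1}(odd_double_half p) p_odd.
set m := p./2 in pE *; pose q := m./2.
have mE : m = (odd m + q.*2)%N by rewrite odd_double_half.
have s_m : (-1) ^+ (2 * q) = 1 :> R[i] by rewrite exprM sqrrN expr1n expr1n.
have i_m : 'i%C ^+ (2 * q) = (-1) ^+ q :> R[i] by rewrite exprM sqr_i.
case: ifP => p4.
  have {}mE : m = (2 * q)%N.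
    by move: mE p4; rewrite pE; case: (odd m) => /=; rewrite -!muln2; lia.
  have -> : 'C(m.+1, 2) = (q * (2 * q).+1)%N.
    by rewrite bin2 /= mE -[RHS]doubleK -muln2; congr _./2; lia.
  rewrite mE s_m mul1r i_m -exprD -signr_odd.
  by rewrite oddD oddM /= mul2n odd_double andbT addbb.
have {}mE : m = (2 * q).+1.
  by move: mE p4; rewrite pE; case: (odd m) => /=; rewrite -!muln2; lia.
have -> : 'C(m.+1, 2) = (q.+1 * (2 * q).+1)%N.
  by rewrite bin2 /= mE -[RHS]doubleK -muln2; congr _./2; lia.
rewrite mE !(exprS _ (2 * q)) s_m i_m mulr1 [X in -1 * X]mulrCA -exprD -signr_odd.
rewrite oddD oddM /= mul2n odd_double /= andbT.
by case: (odd q); rewrite /= expr1 mulrN1 mulN1r opprK.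
Qed.

End ComplexRoots.
(** * Fourier transform on F_p^n *)

Section DotProduct.

Variables (p n : nat).
Implicit Types x y : 'rV['F_p]_n.

Lemma dotpC x y : dotp x y = dotp y x.
Proof. by apply: eq_bigr => i _; rewrite mulrC. Qed.

Lemma dotpDl x1 x2 y : dotp (x1 + x2) y = dotp x1 y + dotp x2 y.
Proof. by rewrite -big_split; apply: eq_bigr => i _; rewrite mxE mulrDl. Qed.

Lemma dotpZl a x y : dotp (a *: x) y = a * dotp x y.
Proof. by rewrite mulr_sumr; apply: eq_bigr => i _; rewrite mxE mulrA. Qed.

Lemma dotpDr x y1 y2 : dotp x (y1 + y2) = dotp x y1 + dotp x y2.
Proof. by rewrite !(dotpC x) dotpDl. Qed.

Lemma dotpNl x y : dotp (- x) y = - dotp x y.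
Proof. by rewrite -scaleN1r dotpZl mulN1r. Qed.

Lemma dotpNr x y : dotp x (- y) = - dotp x y.
Proof. by rewrite !(dotpC x) dotpNl. Qed.

Lemma dotp0l y : dotp 0 y = 0.
Proof. by rewrite -(scale0r 0) dotpZl mul0r. Qed.

Lemma dotp0r x : dotp x 0 = 0.
Proof. by rewrite dotpC dotp0l. Qed.

Lemma dotp_neq0 x : x != 0 -> exists y, dotp y x != 0.
Proof.
case/matrix0Pn => i [j xij]; exists (delta_mx 0 j).
rewrite /dotp (bigD1 j) //= big1 => [|k kj]; last first.
  by rewrite mxE (negPf kj) andbF mul0r.
by rewrite mxE !eqxx mul1r addr0 -(ord1 i).
Qed.

End DotProduct.

Section Fourier.

Variables (p n : nat) (C : numClosedFieldType) (z : C).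
Hypotheses (p_pr : prime p) (z_prim : p.-primitive_root z).

Local Notation V := 'rV['F_p]_n.
Local Notation e := (@ezeta p C z).

Lemma card_rV : #|{: V}| = (p ^ n)%N.
Proof. by rewrite card_mx mul1n card_Fp. Qed.

Lemma sum_char (x : V) : \sum_(a : V) e (dotp a x) = (x == 0)%:R * p%:R ^+ n.
Proof.
case: eqP => [->|/eqP /dotp_neq0 [y yx]].
  rewrite (eq_bigr (fun=> 1)) => [|a _]; last by rewrite dotp0r ezeta0.
  by rewrite sumr_const card_rV mul1r natrX.
have ey : 1 - e (dotp y x) != 0.
  by rewrite subr_eq0 eq_sym -(@ezeta0 p _ z) (inj_eq (ezeta_inj p_pr z_prim)).
apply: (mulfI ey); rewrite mul0r mulr0 mulrBl mul1r mulr_sumr.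
rewrite [X in X - _](reindex_inj (addrI y)) /=.
by rewrite -sumrB big1 // => a _; rewrite dotpDl (ezetaD p_pr z_prim) subrr.
Qed.

(** Not normalised, to match the Walsh transform: applying it twice gives a factor p^n and a
    reflection, and the latter disappears on even functions. *)
Definition ft (phi : V -> C) (a : V) : C := \sum_x phi x * e (- dotp a x).

Lemma eq_ft phi psi : phi =1 psi -> ft phi =1 ft psi.
Proof. by move=> h a; apply: eq_bigr => x _; rewrite h. Qed.

Lemma ftK phi x : ft (ft phi) x = p%:R ^+ n * phi (- x).
Proof.
rewrite /ft; under eq_bigr do rewrite mulr_suml.
rewrite exchange_big (bigD1 (- x)) //= [X in _ + X]big1 => [|y yx].
  rewrite (eq_bigr (fun=> phi (- x))) => [|a _].
    by rewrite addr0 sumr_const card_rV [RHS]mulrC -natrX mulr_natr.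
  rewrite -mulrA -(ezetaD p_pr z_prim) dotpNr opprK dotpC subrr ezeta0.
  by rewrite mulr1.
under eq_bigr => a _ do
  rewrite -mulrA -(ezetaD p_pr z_prim) (dotpC x) -opprD -dotpDr -dotpNr.
by rewrite -mulr_sumr sum_char oppr_eq0 addr_eq0 (negPf yx) mul0r mulr0.
Qed.

Lemma ftZ c phi a : ft (fun x => c * phi x) a = c * ft phi a.
Proof. by rewrite mulr_sumr; apply: eq_bigr => x _; rewrite mulrA. Qed.

Lemma ftD phi psi a : ft (fun x => phi x + psi x) a = ft phi a + ft psi a.
Proof. by rewrite -big_split; apply: eq_bigr => x _; rewrite mulrDl. Qed.

Lemma ftN phi a : ft (fun x => - phi x) a = - ft phi a.
Proof. by rewrite -sumrN; apply: eq_bigr => x _; rewrite mulNr. Qed.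

Lemma ft_sum (I : Type) (r : seq I) (Q : pred I) (F : I -> V -> C) a :
  ft (fun x => \sum_(i <- r | Q i) F i x) a = \sum_(i <- r | Q i) ft (F i) a.
Proof.
rewrite /ft exchange_big; apply: eq_bigr => x _ /=.
by rewrite mulr_suml.
Qed.

Lemma ft_even phi : (forall x, phi (- x) = phi x) ->
  forall a, ft phi (- a) = ft phi a.
Proof.
move=> phiN a; rewrite /ft (reindex_inj oppr_inj) /=; apply: eq_bigr => x _.
by rewrite phiN dotpNl dotpNr opprK.
Qed.

Lemma ft_conv phi psi x :
  p%:R ^+ n * (\sum_y phi (x - y) * psi y) =
  ft (fun a => ft phi a * ft psi a) (- x).
Proof.
have H a : ft phi a * ft psi a = ft (fun u => \sum_y phi (u - y) * psi y) a.
  rewrite ft_sum /ft mulr_sumr; apply: eq_bigr => y _.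
  rewrite mulr_suml (reindex_inj (addIr (- y))) /=; apply: eq_bigr => u _.
  by rewrite mulrACA -(ezetaD p_pr z_prim) -opprD -dotpDr subrK.
by rewrite (eq_ft H) ftK opprK.
Qed.

End Fourier.
(** * Walsh transforms of bent functions *)

Section Walsh.

Variables (R : realType) (p n : nat).
Hypotheses (p_pr : prime p) (p_odd : odd p) (n_odd : odd n).

Local Notation V := 'rV['F_p]_n.
Local Notation z := (xi R p).
Local Notation e := (@ezeta p _ z).
Local Notation eta := (@legendre p).
Let z_prim := xi_prim R p_pr p_odd.
Implicit Types f : V -> 'F_p.

Lemma walshE f a : walsh R f a = ft z (fun x => e (f x)) a.
Proof.
apply: eq_bigr => x _; rewrite -(ezetaD p_pr z_prim); reflexivity.
Qed.

Definition walsh_unit : R[i] := mu R p n * sqrt_pn R p n.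
Local Notation g := walsh_unit.

Lemma walsh_unitE : g = p%:R ^+ n./2 * gauss p z.
Proof.
have nE : n = (n./2 * 2).+1 by rewrite muln2 -[LHS]odd_double_half n_odd.
rewrite /g /mu /sqrt_pn (gauss_value R p_pr p_odd).
(* Odd squares are 1 modulo 4 and n is odd, so [mu] is governed by p alone, as is the Gauss sum. *)
have -> : (p ^ n %% 4 = p %% 4)%N.
  have p2 : (p ^ 2 %% 4 = 1)%N.
    have pE : p = (p./2 * 2).+1 by rewrite muln2 -[LHS]odd_double_half p_odd.
    by rewrite pE -(modnXm 2 4) -addn1; lia.
  by rewrite {1}nE expnS [(n./2 * 2)%N]mulnC expnM -modnMmr -modnXm p2 exp1n muln1.
rewrite mulrCA; congr (_ * _).
have -> : (p%:R : R) ^+ n = (p%:R ^+ n./2) ^+ 2 * p%:R.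
  by rewrite -exprM -exprSr -nE.
rewrite sqrtrM ?sqr_ge0 // sqrtr_sqr ger0_norm ?exprn_ge0 ?ler0n //.
by rewrite rmorphM rmorphXn rmorph_nat.
Qed.

Lemma walsh_unit_conj : g^* = (eta (-1))%:~R * g.
Proof.
rewrite walsh_unitE rmorphM rmorphXn rmorph_nat /=.
by rewrite (gauss_conj p_pr z_prim p_odd) mulrCA.
Qed.

Lemma walsh_unit_norm : g * g^* = p%:R ^+ n.
Proof.
have nE : n = (2 * n./2).+1 by rewrite mul2n -[LHS]odd_double_half n_odd.
rewrite walsh_unitE rmorphM rmorphXn rmorph_nat /= mulrACA.
by rewrite (gauss_norm p_pr z_prim p_odd) -exprD addnn -mul2n -exprSr -nE.
Qed.

Let pn0 : (p%:R : R[i]) ^+ n != 0.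
Proof. by rewrite expf_neq0 // pnatr_eq0 -lt0n prime_gt0. Qed.

Lemma walsh_unit_neq0 : g != 0.
Proof. by apply: contraNneq pn0 => g0; rewrite -walsh_unit_norm g0 mul0r. Qed.

Lemma cycint_walsh f a : cycint z (walsh R f a).
Proof.
have := @cycint_sum p _ z _ (fun=> 1) (fun x : V => f x - dotp a x).
rewrite /walsh; congr cycint; apply: eq_bigr => x _; exact: mul1r.
Qed.

Lemma bent_norm f a : bent R f -> walsh R f a * (walsh R f a)^* = p%:R ^+ n.
Proof.
move=> /(_ a) h; rewrite -normCK h /sqrt_pn -rmorphXn /= sqr_sqrtr ?exprn_ge0 ?ler0n //.
by rewrite rmorphXn rmorph_nat.
Qed.

(** The squared norm p^n has an odd exponent. Multiplying by the conjugate Gauss sum gives an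
    element of squared norm p^(n+1), to which [cycint_norm_Xp] applies. *)
Lemma bent_walsh f a : bent R f ->
  exists s : bool, exists j, walsh R f a = (-1) ^+ s * g * e j.
Proof.
move=> fb; pose G := gauss p z.
have nE : (2 * n./2.+1 = n.+1)%N by rewrite mul2n doubleS -[in RHS](odd_double_half n) n_odd.
have [||s [j h]] := @cycint_norm_Xp p _ z p_pr z_prim n./2.+1 (walsh R f a * G^*).
- apply: cycintM; first exact: cycint_walsh.
  apply: (cycint_conj p_pr z_prim); exact: cycint_gauss.
- rewrite nE rmorphM /= conjCK mulrACA bent_norm // [G^* * G]mulrC.
  by rewrite (gauss_norm p_pr z_prim p_odd) -exprSr.
exists s, j; have p0 : (p%:R : R[i]) != 0 by rewrite pnatr_eq0 -lt0n prime_gt0.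
apply: (mulIf p0); rewrite -[in LHS](gauss_norm p_pr z_prim p_odd) -/G.
by rewrite [G * _]mulrC mulrA h walsh_unitE exprS -/G; ring.
Qed.

Lemma bent_dual f a : bent R f ->
  walsh R f a = g * e (dual R f a) \/ walsh R f a = - (g * e (dual R f a)).
Proof.
move=> fb; rewrite /dual; case: pickP => [j /orP [] /eqP -> /=|h]; [by left|by right|].
have [s [j wE]] := bent_walsh a fb; have := h j.
by rewrite wE; case: (s); rewrite ?expr0 ?expr1 ?mul1r ?mulN1r ?mulNr -/g eqxx ?orbT.
Qed.

Lemma bent_walsh_dual f a : bent R f ->
  walsh R f a = (if a \in Bplus R f then 1 else -1) * (g * e (dual R f a)).
Proof.
move=> fb; rewrite inE; case: ifP => [/eqP ->|h]; first by rewrite mul1r.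
have [wE|->] := bent_dual a fb; last by rewrite mulN1r.
by move: h; rewrite wE eqxx.
Qed.

Lemma bent_Bminus f : bent R f -> Bminus R f = ~: Bplus R f.
Proof.
move=> fb; apply/setP => a; rewrite !inE -/g.
have [-> | ->] := bent_dual a fb; rewrite -/(e _) ?eqxx /=.
  rewrite -subr_eq0 opprK -mulr2n mulrn_eq0 mulf_eq0 (negPf walsh_unit_neq0).
  by rewrite (negPf (ezeta_neq0 _ _ _)).
rewrite eq_sym -subr_eq0 opprK -mulr2n mulrn_eq0 mulf_eq0 (negPf walsh_unit_neq0).
by rewrite (negPf (ezeta_neq0 _ _ _)).
Qed.

End Walsh.

(** * Transforms of a bent function and of its dual *)

Section DualPair.

Variables (R : realType) (p n : nat).
Hypotheses (p_pr : prime p) (p_odd : odd p) (n_odd : odd n).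

Local Notation V := 'rV['F_p]_n.
Local Notation z := (xi R p).
Local Notation e := (@ezeta p _ z).
Local Notation eta := (@legendre p).
Local Notation g := (walsh_unit R p n).
Let z_prim := xi_prim R p_pr p_odd.

Variable f : V -> 'F_p.
Hypotheses (f_bent : bent R f) (dual_bent_f : bent R (dual R f)).
Hypotheses (f_even : forall x, f (- x) = f x) (f0 : f 0 = 0).
Local Notation D := (dual R f).

Lemma walsh_even a : walsh R f (- a) = walsh R f a.
Proof.
by rewrite !walshE //; apply: ft_even => x; rewrite f_even.
Qed.

Lemma dual_even a : D (- a) = D a.
Proof. by rewrite /dual walsh_even. Qed.

Lemma Bplus_even a : (- a \in Bplus R f) = (a \in Bplus R f).
Proof. by rewrite !inE dual_even walsh_even. Qed.

Let g_norm := walsh_unit_norm R p_pr p_odd n_odd.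
Let g_neq0 := walsh_unit_neq0 R p_pr p_odd n_odd.

Let sgn (a : V) : R[i] := if a \in Bplus R f then 1 else -1.

(** Fourier inversion of the Walsh transform of [f], divided by g; the factor g^* is p^n / g. *)
Lemma ft_signed_dual x : ft z (fun a => sgn a * e (D a)) x = g^* * e (f x).
Proof.
apply: (mulfI g_neq0); rewrite mulrA g_norm -ftZ.
rewrite -[f x]f_even -(ftK p_pr z_prim (fun x => e (f x))).
apply: eq_ft => a; rewrite -walshE // bent_walsh_dual //.
by rewrite -/(sgn a) mulrCA mulrA.
Qed.

Lemma ft_dual x : ft z (fun a => e (D a)) x =
  (if x \in Bplus R D then 1 else -1) * (g * e (dual R D x)).
Proof. by rewrite -walshE // bent_walsh_dual. Qed.

Lemma walsh_unit_conj_sqr : g^* * g^* = (eta (-1))%:~R * p%:R ^+ n.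
Proof. by rewrite {1}walsh_unit_conj // -mulrA g_norm. Qed.

Lemma cycint_ft (c : V -> int) (k : V -> 'F_p) x :
  cycint z (ft z (fun a => (c a)%:~R * e (k a)) x).
Proof.
have := @cycint_sum p _ z _ c (fun a : V => k a - dotp x a).
congr cycint; apply: eq_bigr => a _.
by rewrite (ezetaD p_pr z_prim) mulrA.
Qed.

Lemma cycint_conj_unit : cycint z g^*.
Proof.
apply: (cycint_conj p_pr z_prim); rewrite walsh_unitE //; apply: cycintM.
  by apply: cycintX; exact: (cycint_int _ p).
exact: cycint_gauss.
Qed.

(* The sum of the transforms of e(f* ) and of sgn e(f* ) is divisible by 2, which forces
   the two roots of unity occurring in their values to agree. *)
Lemma dual_dual x : dual R D x = f x.
Proof.
pose s1 := x \notin Bplus R D; pose s2 := odd p./2.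
(* The factor g^* turns both transforms into p^n times signed roots of unity, since g g^* = p^n and
   g^* g^* = eta(-1) p^n; this p^n is the odd [N] of [ezeta_mod2]. *)
pose y := g^* * ft z (fun a => ((a \in Bplus R f)%:R : int)%:~R * e (D a)) x.
have cy : cycint z y.
  apply: cycintM; [exact: cycint_conj_unit|exact: cycint_ft].
apply: (@ezeta_mod2 p _ z p_pr z_prim p_odd y s1 s2 (p ^ n)) => //.
  by rewrite oddX p_odd orbT.
have -> : 2%:R * y = g^* * (ft z (fun a => e (D a)) x +
                            ft z (fun a => sgn a * e (D a)) x).
  rewrite /y -ftD [LHS]mulrCA -(ftZ z 2%:R); congr (_ * _).
  apply: eq_ft => a; rewrite /sgn.
  by case: ifP => _; rewrite ?mulr0n ?mulr1n; ring.
rewrite ft_signed_dual ft_dual mulrDr mulrA walsh_unit_conj_sqr natrX.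
have -> : (eta (-1))%:~R = (-1) ^+ s2 :> R[i].
  by rewrite legendreN1 // /s2 -signr_odd rmorphXn rmorphN1.
have -> : (if x \in Bplus R D then 1 else -1) = (-1) ^+ s1 :> R[i].
  by rewrite /s1; case: ifP.
by rewrite -g_norm; move: (_ ^+ s1) (_ ^+ s2) => u1 u2; ring.
Qed.

(** As [f] is even with [f 0 = 0], pairing x with -x gives a Walsh value 1 + 2y at 0. It is also a
    signed g e(D 0), and multiplying by g^* gives the relation excluded by [gauss_mod2] for nonzero
    [D 0]. *)
Lemma dual0 : D 0 = 0.
Proof.
(* An arbitrary choice of one vector from each pair {x, -x}, made through the enumeration. *)
pose half := [pred x : V | (enum_rank x < enum_rank (- x))%N].
pose y := \sum_(x | half x) e (f x).
have WE : walsh R f 0 = 1 + 2%:R * y.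
  have -> : walsh R f 0 = \sum_x e (f x).
    by apply: eq_bigr => x _; rewrite dotp0l subr0.
  rewrite (bigD1 0) //= f0 ezeta0; congr (_ + _).
  have oppr_neq (x : V) : x != 0 -> x != - x.
    rewrite -addr_eq0 -mulr2n -scaler_nat scaler_eq0 negb_or => ->.
    by rewrite Fp_two_neq0.
  rewrite (bigID half) /= mulr_natl mulr2n; congr (_ + _).
    apply: eq_bigl => x; rewrite andb_idl //; apply: contraTneq => ->.
    by rewrite oppr0 ltnn.
  rewrite (reindex_inj oppr_inj) /=; apply: eq_big => [x|x _]; last by rewrite f_even.
  rewrite oppr_eq0 opprK -leqNgt leq_eqVlt; case: (eqVneq x 0) => [->|x0] /=.
    by rewrite oppr0 ltnn.
  by rewrite (inj_eq val_inj) (inj_eq enum_rank_inj) (negPf (oppr_neq x x0)).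
have cy : cycint z y by apply: cycint_bigsum => x _; apply: cycint_e.
pose s1 := 0 \notin Bplus R f; pose s2 := odd p./2.
have etaE : (eta (-1))%:~R = (-1) ^+ s2 :> R[i].
  by rewrite legendreN1 // /s2 -signr_odd rmorphXn rmorphN1.
have opk k : odd (p ^ k) by rewrite oddX p_odd orbT.
apply: (@gauss_mod2 p _ z p_pr z_prim p_odd y (s1 (+) s2) (p ^ n./2) (p ^ n)) => //.
have := bent_walsh_dual p_pr p_odd n_odd 0 f_bent; rewrite WE => ->.
have gE : g^* = (-1) ^+ s2 * (p%:R ^+ n./2 * gauss p z).
  by rewrite walsh_unit_conj // etaE walsh_unitE.
have -> : (if 0 \in Bplus R f then 1 else -1) = (-1) ^+ s1 :> R[i].
  by rewrite /s1; case: ifP.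
rewrite !natrX signr_addb -g_norm gE.
have := sqrr_sign R[i] s2; move: (_ ^+ s1) (_ ^+ s2) => u1 u2 u22.
by rewrite -[LHS]mul1r -u22; ring.
Qed.

(* The part of the domain of f* that the Fourier transform matches with B_+(f* ). *)
Definition dual_side : {set V} := if (p %% 4 == 1)%N then Bplus R f else Bminus R f.
Local Notation A := dual_side.
Local Notation C := (Bplus R D).

Lemma dual_side_even a : (- a \in A) = (a \in A).
Proof.
by rewrite /A; case: ifP => _; rewrite ?bent_Bminus // ?in_setC Bplus_even.
Qed.

(** Half the sum of the two known transforms: (1 + eta(-1) sgn)/2 is the indicator of A, and since
    eta(-1) g^* = g the right-hand sides reinforce each other on C and cancel off C. *)
Lemma ft_dual_in x : ft z (fun a => (a \in A)%:R * e (D a)) x =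
  g * ((x \in C)%:R * e (f x)).
Proof.
have two0 : 2%:R != 0 :> R[i] by rewrite pnatr_eq0.
apply: (mulfI two0).
transitivity (ft z (fun a => e (D a)) x +
              (eta (-1))%:~R * ft z (fun a => sgn a * e (D a)) x).
  rewrite -!ftZ -ftD; apply: eq_ft => a; rewrite (legendreN1_mod4 p_pr p_odd) /A /sgn.
  case: ifP => _; rewrite ?bent_Bminus // ?in_setC; case: (_ \in _);
    rewrite ?rmorphN1 ?rmorph1 ?mulr1n ?mulr0n /=; ring.
rewrite ft_signed_dual ft_dual dual_dual walsh_unit_conj // (legendreN1_mod4 p_pr p_odd).
case: (p %% 4 == 1)%N; case: (x \in C);
  by rewrite ?rmorphN1 ?rmorph1 ?mulr1n ?mulr0n /=; ring.
Qed.

Lemma ft_dual_out x : ft z (fun a => (a \notin A)%:R * e (D a)) x =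
  - g * ((x \notin C)%:R * e (f x)).
Proof.
transitivity (ft z (fun a => e (D a)) x -
              ft z (fun a => (a \in A)%:R * e (D a)) x).
  rewrite -ftN -ftD; apply: eq_ft => a.
  by case: (a \in A); rewrite ?mulr1n ?mulr0n /=; ring.
rewrite ft_dual_in ft_dual dual_dual.
by case: (x \in C); rewrite ?mulr1n ?mulr0n /=; ring.
Qed.


Let G := gauss p z.

(** Since g = p^((n-1)/2) G is itself an integer combination of powers of xi, [ezeta_galois] applies
    to both sides, and the conjugate of G is eta(c) G. *)
Lemma walsh_unit_galois (I : finType) (m : I -> int) (k : I -> 'F_p) (d : int) b c :
  c != 0 -> \sum_i (m i)%:~R * e (k i) = d%:~R * g * e b ->
  \sum_i (m i)%:~R * e (c * k i) = d%:~R * (eta c)%:~R * g * e (c * b).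
Proof.
move=> c0 h.
have E a : \sum_j (d * (p ^ n./2)%:Z * eta j)%:~R * e (a * (j + b)) =
    d%:~R * p%:R ^+ n./2 * e (a * b) * \sum_j (eta j)%:~R * e (a * j).
  rewrite mulr_sumr; apply: eq_bigr => j _.
  rewrite mulrDr (ezetaD p_pr z_prim) !rmorphM /= -[((p ^ n./2)%:Z)%:~R]/((p ^ n./2)%:R : R[i]).
  by rewrite natrX; ring.
have h' : \sum_i (m i)%:~R * e (k i) =
    \sum_j (d * (p ^ n./2)%:Z * eta j)%:~R * e (j + b).
  have := E 1; under [LHS]eq_bigr do rewrite mul1r.
  move=> ->; rewrite h walsh_unitE // mul1r /gauss.
  by under [X in _ = _ * X]eq_bigr do rewrite mul1r; ring.
rewrite (ezeta_galois p_pr z_prim c0 h') E (gauss_galois z p_pr p_odd c0) walsh_unitE //.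
by ring.
Qed.

Variable h : nat.
Hypotheses (h_gt0 : (0 < h)%N) (h_coprime : coprime (h - 1) (p - 1)).
Hypothesis f_homog : forall a x, a != 0 -> f (a *: x) = a ^+ h * f x.

(* c^(1-h) *)
Definition dual_exponent (c : 'F_p) : 'F_p := c * c^-1 ^+ h.
Local Notation psi := dual_exponent.

(** The automorphism multiplies all exponents by c, so the value at x becomes one at y = c x, and
    f(x) = c^(-h) f(y). The sign [d] covers A with S as well as their complements. *)
Lemma ft_dual_galois (B : {set V}) (D' : {set V}) (d : int) c y : c != 0 ->
  (forall a x, a != 0 -> (a *: x \in D') = (x \in D')) ->
  (forall x, ft z (fun a => (a \in B)%:R * e (D a)) x =
    d%:~R * g * ((x \in D')%:R * e (f x))) ->
  ft z (fun a => (a \in B)%:R * e (c * D a)) y =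
    d%:~R * (eta c)%:~R * g * ((y \in D')%:R * e (psi c * f y)).
Proof.
move=> c0 D'_scale H; pose x := c^-1 *: y.
have yE : y = c *: x by rewrite scalerA mulfV // scale1r.
have ft_sum k w : ft z (fun a => (a \in B)%:R * e (k * D a)) w =
    \sum_(a : V) ((a \in B)%:R : int)%:~R * e (k * D a - dotp w a).
  by apply: eq_bigr => a _; rewrite (ezetaD p_pr z_prim) mulrA rmorph_nat.
have Hx : \sum_(a : V) ((a \in B)%:R : int)%:~R * e (D a - dotp x a) =
    (d * (x \in D')%:R)%:~R * g * e (f x).
  transitivity (ft z (fun a => (a \in B)%:R * e (1 * D a)) x).
    by rewrite ft_sum; apply: eq_bigr => a _; rewrite mul1r.
  transitivity (ft z (fun a => (a \in B)%:R * e (D a)) x).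
    by apply: eq_ft => a; rewrite mul1r.
  by rewrite H rmorphM rmorph_nat /=; ring.
have := walsh_unit_galois c0 Hx.
rewrite ft_sum => E.
transitivity (\sum_(a : V) ((a \in B)%:R : int)%:~R * e (c * (D a - dotp x a))).
  by apply: eq_bigr => a _; rewrite yE dotpZl mulrBr.
have cV : c^-1 != 0 by rewrite invr_eq0.
rewrite E {E} rmorphM rmorph_nat /x D'_scale // f_homog // /psi -[c * _ * f y]mulrA.
by rewrite /=; ring.
Qed.

Lemma dual_exponentE c : psi c = c^-1 ^+ (h - 1).
Proof.
have hE : h = (h - 1).+1 by rewrite subnSK ?subn0.
have [->|c0] := eqVneq c 0; last by rewrite /psi {1}hE exprS mulrA mulfV // mul1r.
(* At c = 0 only [h = 1] could spoil the identity, and then coprimality would give p = 2. *)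
rewrite /psi mul0r invr0 expr0n; case: eqP => // h1.
move: h_coprime; rewrite h1 /coprime gcd0n => /eqP p1.
by move: p_odd; rewrite (_ : p = 2%N) // -[p]prednK ?prime_gt0 // -subn1 p1.
Qed.

Lemma dual_exponent_inj : injective psi.
Proof.
have ck : coprime (h - 1) p.-1 by rewrite -subn1.
have psi0 (c : 'F_p) : (psi c == 0) = (c == 0).
  rewrite /psi mulf_eq0 expf_eq0 invr_eq0.
  by case: eqP => //= _; rewrite andbF.
move=> c c'; have [->|c0] := eqVneq c 0.
  have -> : psi 0 = 0 by apply/eqP; rewrite psi0.
  by move/esym/eqP; rewrite psi0 => /eqP.
move=> E; have c'0 : c' != 0 by rewrite -psi0 -E psi0.
apply: invr_inj; apply: (Fp_expr_inj p_pr ck); rewrite ?inE ?invr_eq0 //.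
by rewrite -!dual_exponentE.
Qed.

Let h_even : ~~ odd h := even_of_coprime_pred (prime_gt0 p_pr) p_odd h_gt0 h_coprime.

Lemma legendre_dual_exponent c : eta (psi c) = eta c.
Proof.
have [->|c0] := eqVneq c 0; first by rewrite /psi mul0r.
rewrite /psi legendreM // legendreX // -[h]odd_double_half (negPf h_even) add0n.
by rewrite -muln2 mulnC exprM legendre_sqr ?invr_eq0 // expr1n mulr1.
Qed.

Lemma gauss_neq0 : G != 0.
Proof.
have : (p%:R : R[i]) != 0 by rewrite pnatr_eq0 -lt0n prime_gt0.
by apply: contraNneq => G0; rewrite -(gauss_norm p_pr z_prim p_odd) -/G G0 mul0r.
Qed.

Lemma gauss_galois0 b : \sum_j (eta j)%:~R * e (j * b) = (eta b)%:~R * G.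
Proof.
have [->|b0] := eqVneq b 0.
  rewrite legendre0 mul0r (eq_bigr (fun j => (eta j)%:~R)) => [|j _].
    by rewrite -rmorph_sum legendre_sum0.
  by rewrite mulr0 ezeta0 mulr1.
by rewrite -(gauss_galois z p_pr p_odd b0); apply: eq_bigr => j _; rewrite [b * j]mulrC.
Qed.

(** Summing e(c t) over nonzero c gives p [t = 0] - 1. On the transform side eta(c) = eta(psi c),
    and reindexing by psi leaves a Gauss sum twisted by [f y]. *)
Lemma ft_dual_delta (B D' : {set V}) (d : int) y :
  (forall a x, a != 0 -> (a *: x \in D') = (x \in D')) ->
  (forall x, ft z (fun a => (a \in B)%:R * e (D a)) x =
    d%:~R * g * ((x \in D')%:R * e (f x))) ->
  ft z (fun a => (a \in B)%:R * (p%:R * (D a == 0)%:R - 1)) y =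
    d%:~R * g * G * ((y \in D')%:R * (eta (f y))%:~R).
Proof.
move=> D'_scale H.
transitivity (ft z (fun a => \sum_(c : 'F_p | c != 0) (a \in B)%:R * e (c * D a)) y).
  apply: eq_ft => a; rewrite -mulr_sumr; congr (_ * _).
  have := ezeta_sum p_pr z_prim (D a); rewrite (bigD1 0) //= mul0r ezeta0.
  move=> E; apply: (addrI 1); rewrite [RHS]E addrC subrK.
  by case: eqP => _; rewrite ?mulr0 ?mulr1.
rewrite ft_sum (eq_bigr (fun c => (d%:~R * g * (y \in D')%:R) *
    ((eta (psi c))%:~R * e (psi c * f y)))) => [|c c0]; last first.
  by rewrite (ft_dual_galois _ c0 D'_scale H) legendre_dual_exponent; ring.
rewrite -mulr_sumr.
have : \sum_c (eta (psi c))%:~R * e (psi c * f y) = (eta (f y))%:~R * G.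
  by rewrite -gauss_galois0 [RHS](reindex_inj dual_exponent_inj).
rewrite (bigD1 0) //= legendre_dual_exponent legendre0 mul0r add0r => ->.
by ring.
Qed.

(** Here the weight eta(c) cancels the one produced by the automorphism, so the zero test appears on
    the side of [f]. *)
Lemma ft_dual_legendre (B D' : {set V}) (d : int) y :
  (forall a x, a != 0 -> (a *: x \in D') = (x \in D')) ->
  (forall x, ft z (fun a => (a \in B)%:R * e (D a)) x =
    d%:~R * g * ((x \in D')%:R * e (f x))) ->
  ft z (fun a => (a \in B)%:R * (eta (D a))%:~R) y =
    d%:~R * g / G * ((y \in D')%:R * (p%:R * (f y == 0)%:R - 1)).
Proof.
move=> D'_scale H; apply: (mulfI gauss_neq0); rewrite -ftZ.
transitivity (ft z (fun a => \sum_(c : 'F_p | c != 0)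
    (eta c)%:~R * ((a \in B)%:R * e (c * D a))) y).
  apply: eq_ft => a; rewrite mulrCA [G * _]mulrC -gauss_galois0 (bigD1 0) //=.
  rewrite legendre0 mul0r add0r mulr_sumr; apply: eq_bigr => c _.
  by rewrite mulrCA.
rewrite ft_sum (eq_bigr (fun c => (d%:~R * g * (y \in D')%:R) *
    e (psi c * f y))) => [|c c0]; last first.
  rewrite ftZ (ft_dual_galois _ c0 D'_scale H).
  transitivity (((eta c) ^+ 2)%:~R * (d%:~R * g * (y \in D')%:R * e (psi c * f y))).
    by rewrite rmorphXn /=; ring.
  by rewrite legendre_sqr // mul1r.
rewrite -mulr_sumr.
have := ezeta_sum p_pr z_prim (f y); rewrite (reindex_inj dual_exponent_inj) /=.
rewrite (bigD1 0) //= {1}/psi !mul0r ezeta0 => E.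
have -> : \sum_(c : 'F_p | c != 0) e (psi c * f y) = p%:R * (f y == 0)%:R - 1.
  apply: (addrI 1); rewrite [LHS]E [RHS]addrC subrK.
  by case: eqP => _; rewrite ?mulr1 ?mulr0.
by field; exact: gauss_neq0.
Qed.

End DualPair.
(** * Translation schemes from a Fourier-stable partition *)

Section LabelScheme.

Variables (p n : nat) (C : numClosedFieldType) (z : C).
Hypotheses (p_pr : prime p) (z_prim : p.-primitive_root z).

Local Notation V := 'rV['F_p]_n.
Local Notation eta := (@legendre p).
Local Notation ft := (@ft p n C z).

Let p0 : p%:R != 0 :> C. Proof. by rewrite pnatr_eq0 -lt0n prime_gt0. Qed.
Let pn0 : p%:R ^+ n != 0 :> C. Proof. exact: expf_neq0. Qed.

(** [S] will be the subspace on the side considered and [P] the orthogonal complement of the one on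
    the other side. Not all values occur; [label_valid] lists the constraints. *)
Definition label (P S : {set V}) (f : V -> 'F_p) (x : V) :=
  (x == 0, x \in P, x \in S, f x == 0, f x \in SQ p).

(** Membership in the span of the class indicators, the space that [ft] has to preserve between the
    two sides. *)
Definition factors (T : Type) (l : V -> T) (phi : V -> C) :=
  exists Phi, forall x, phi x = Phi (l x).

Lemma legendre_SQ (a : 'F_p) :
  eta a = if a == 0 then 0 else if a \in SQ p then 1 else -1.
Proof. by rewrite /legendre inE; case: eqP. Qed.

(** The functions 1, p [y = 0] - 1 and eta form a basis of the functions of y that distinguish only
    zero, squares and nonsquares; they are those whose transforms are known. *)
Lemma class_function (u : bool -> bool -> C) : exists a : C * C * C, forall y : 'F_p,
  u (y == 0) (y \in SQ p) =
  a.1.1 + a.1.2 * (p%:R * (y == 0)%:R - 1) + a.2 * (eta y)%:~R.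
Proof.
pose a0 := (u false true + u false false) / 2%:R.
pose a1 := (u true false - a0) / p%:R.
exists (a0 + a1, a1, (u false true - u false false) / 2%:R) => y /=.
rewrite legendre_SQ inE; case: eqVneq => [_|_] /=.
  by rewrite /a1 /a0; field.
by case: ifP => _; rewrite ?rmorphN1 ?rmorph1 /a1 /a0; field.
Qed.

Lemma ft_scale_inv phi psi k : (forall x, phi (- x) = phi x) -> k != 0 ->
  (forall a, ft phi a = k * psi a) -> forall a, ft psi a = p%:R ^+ n / k * phi a.
Proof.
move=> phiN k0 H a; apply: (mulfI k0); rewrite -ftZ -(eq_ft _ H) ftK // phiN.
by field.
Qed.

Lemma ft_dirac y : ft (fun x => (x == 0)%:R) y = 1.
Proof.
rewrite /ft (bigD1 0) //= eqxx dotp0r oppr0 ezeta0 mul1r big1 ?addr0 // => x /negPf ->.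
by rewrite mul0r.
Qed.

Lemma ft_one y : ft (fun=> 1) y = p%:R ^+ n * (y == 0)%:R.
Proof.
transitivity (ft (ft (fun x => (x == 0)%:R)) y).
  by apply: eq_ft => x; rewrite ft_dirac.
by rewrite ftK // oppr_eq0.
Qed.

Section Direction.

Variables (PT T PS S : {set V}) (F f : V -> 'F_p).
Hypotheses (PT0 : 0 \in PT) (PT_sub : {subset PT <= T}).
Hypothesis F_PT : forall x, x \in PT -> F x = 0.
Variables c1 c2 k1 k2 k3 k4 : C.
Hypothesis ft_PT : forall y, ft (fun x => (x \in PT)%:R) y = c1 * (y \in S)%:R.
Hypothesis ft_T : forall y, ft (fun x => (x \in T)%:R) y = c2 * (y \in PS)%:R.
Hypothesis ft_Td : forall y,
  ft (fun x => (x \in T)%:R * (p%:R * (F x == 0)%:R - 1)) y =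
  k1 * ((y \in S)%:R * (eta (f y))%:~R).
Hypothesis ft_Te : forall y, ft (fun x => (x \in T)%:R * (eta (F x))%:~R) y =
  k2 * ((y \in S)%:R * (p%:R * (f y == 0)%:R - 1)).
Hypothesis ft_Nd : forall y,
  ft (fun x => (x \notin T)%:R * (p%:R * (F x == 0)%:R - 1)) y =
  k3 * ((y \notin S)%:R * (eta (f y))%:~R).
Hypothesis ft_Ne : forall y, ft (fun x => (x \notin T)%:R * (eta (F x))%:~R) y =
  k4 * ((y \notin S)%:R * (p%:R * (f y == 0)%:R - 1)).

(** A function of the label is a combination of functions with known transforms: [class_function]
    handles T and its complement, and corrections on [PT] and at 0 supply the rest. *)
Lemma ft_factors phi :
  factors (label PT T F) phi -> factors (label PS S f) (ft phi).
Proof.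
case=> Phi phiE.
have [[[a0 a1] a2] /= aE] := class_function (fun d s => Phi (false, false, true, d, s)).
have [[[b0 b1] b2] /= bE] := class_function (fun d s => Phi (false, false, false, d, s)).
(* The values on the three strata of zeros of F inside T: outside [PT], in [PT] away from 0, and at
   0. Their differences weight the corrections. *)
pose w1 := Phi (false, false, true, true, false).
pose w2 := Phi (false, true, true, true, false).
pose w3 := Phi (true, true, true, true, false).
pose phi' x := a0 * (x \in T)%:R + a1 * ((x \in T)%:R * (p%:R * (F x == 0)%:R - 1)) +
  a2 * ((x \in T)%:R * (eta (F x))%:~R) +
  b0 * (1 + - (x \in T)%:R) + b1 * ((x \notin T)%:R * (p%:R * (F x == 0)%:R - 1)) +
  b2 * ((x \notin T)%:R * (eta (F x))%:~R) + (w2 - w1) * (x \in PT)%:R +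
  (w3 - w2) * (x == 0)%:R.
have SQ0 : 0 \in SQ p = false by rewrite inE eqxx.
have phiE' : phi =1 phi'.
  move=> x; rewrite phiE /label /phi'.
  case: (boolP (x \in PT)) => [xP|xP].
    have := aE 0; rewrite eqxx SQ0 legendre0 mulr0 addr0 => E.
    rewrite (PT_sub xP) F_PT // eqxx SQ0 legendre0.
    case: eqVneq => _; rewrite ?mulr1n ?mulr0n; rewrite /= -/w1 -/w2 -/w3 in E *.
      by transitivity (w1 + (w2 - w1) + (w3 - w2)); [ring|rewrite E; ring].
    by transitivity (w1 + (w2 - w1)); [ring|rewrite E; ring].
  have -> : (x == 0) = false by apply: contraNF xP => /eqP ->.
  case: (boolP (x \in T)) => xT; rewrite ?mulr1n ?mulr0n /=.
    by rewrite aE; ring.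
  by rewrite bE; ring.
exists (fun l : bool * bool * bool * bool * bool =>
  let: (x0, xP, xS, d, s) := l in
  let et : C := if d then 0 else if s then 1 else -1 in
  a0 * (c2 * xP%:R) + a1 * (k1 * (xS%:R * et)) +
  a2 * (k2 * (xS%:R * (p%:R * d%:R - 1))) +
  b0 * (p%:R ^+ n * x0%:R + - (c2 * xP%:R)) + b1 * (k3 * ((~~ xS)%:R * et)) +
  b2 * (k4 * ((~~ xS)%:R * (p%:R * d%:R - 1))) + (w2 - w1) * (c1 * xS%:R) +
  (w3 - w2) * 1).
move=> y; rewrite (eq_ft z phiE') /phi' /label !ftD !ftZ ftD ftN.
rewrite ft_PT ft_T ft_Td ft_Te ft_Nd ft_Ne ft_dirac ft_one.
have -> : (eta (f y))%:~R = if f y == 0 then 0 else if f y \in SQ p then 1 else -1 :> C.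
  by rewrite legendre_SQ; case: ifP => // _; case: ifP => _; rewrite ?rmorphN1 ?rmorph1.
by [].
Qed.

End Direction.

Lemma indexed_partition_index (T : finType) d (U : 'I_d.+1 -> {set T}) (k : T -> 'I_d.+1) :
  (forall i x, (x \in U i) = (k x == i)) -> (forall i, exists x, k x = i) ->
  Defs.indexed_partition U.
Proof.
move=> UE ks; split=> [i j Uij|].
  have [x xi] := ks i; have : x \in U j by rewrite -Uij UE xi.
  by rewrite UE xi => /eqP.
apply/and3P; split.
- apply/eqP/setP => x; rewrite inE; apply/bigcupP.
  by exists (U (k x)); rewrite ?imset_f // UE.
- apply/trivIsetP => _ _ /imsetP [i _ ->] /imsetP [j _ ->] Uij.
  rewrite -setI_eq0; apply/eqP/setP => x; rewrite !inE !UE; apply/negP.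
  by move=> /andP [/eqP xi /eqP xj]; case/negP: Uij; rewrite -xi -xj.
apply/negP => /imsetP [i _ Ui]; have [x xi] := ks i.
by have := in_set0 x; rewrite Ui UE xi eqxx.
Qed.

(** Transforming two class indicators, multiplying pointwise and transforming back goes from
    functions of [l] to functions of [l'] and back to functions of [l], so their convolution depends
    on the class alone. *)
Lemma scheme_of_labels (K K' : eqType) d (U : d.+1.-tuple {set V}) (k : V -> 'I_d.+1)
    (l : V -> K) (l' : V -> K') :
  (forall i x, (x \in tnth U i) = (k x == i)) -> (forall i, exists x, k x = i) ->
  (forall x, (k x == ord0) = (x == 0)) -> (forall x, k (- x) = k x) ->
  (forall x y, (k x == k y) = (l x == l y)) ->
  (forall phi, factors l phi -> factors l' (ft phi)) ->
  (forall phi, factors l' phi -> factors l (ft phi)) ->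
  induces_symmetric_scheme d U.
Proof.
move=> UE ks k0 kN kl ll' l'l.
have RE i x y : ((x, y) \in difference_relation (tnth U i)) = (k (x - y) == i).
  by rewrite inE /= UE.
have Rsym j : transpose (difference_relation (tnth U j)) = difference_relation (tnth U j).
  by apply/setP => -[x y]; rewrite inE /= !RE -opprB kN.
split; first exact: indexed_partition_index UE ks.
  by apply/setP => x; rewrite UE k0 inE.
split=> //; split.
- apply: (@indexed_partition_index _ _ _ (fun xy => k (xy.1 - xy.2))).
    by move=> i [x y]; rewrite RE.
  by move=> i; have [x xi] := ks i; exists (x, 0); rewrite subr0.
- by apply/setP => -[x y]; rewrite RE inE /= k0 subr_eq0.
- by move=> j; exists j.
move=> u v w.
(* With t = x - y and s = z - y this is the intersection number of the pair (x, y). *)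
pose N t := #|[set s | (k (t - s) == u) && (k s == v)]|.
have NE t : (N t)%:R = (p%:R ^+ n)^-1 *
    ft (fun a => ft (fun x => (k x == u)%:R) a * ft (fun x => (k x == v)%:R) a) (- t).
  rewrite -ft_conv // mulKf //.
  rewrite /N -sum1_card natr_sum big_mkcond /=; apply: eq_bigr => s _.
  by rewrite inE; case: (_ == u); case: (_ == v); rewrite ?mulr1 ?mulr0.
have lu i : factors l (fun x => (k x == i)%:R : C).
  have [x xi] := ks i; exists (fun c => (c == l x)%:R) => y.
  by rewrite -kl xi.
have [Phi PhiE] : factors l (ft (fun a =>
    ft (fun x => (k x == u)%:R) a * ft (fun x => (k x == v)%:R) a)).
  apply: l'l; have [P1 P1E] := ll' _ (lu u); have [P2 P2E] := ll' _ (lu v).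
  by exists (fun c => P1 c * P2 c) => a; rewrite P1E P2E.
have [t tw] := ks w; exists (N t) => x y; rewrite RE => /eqP xyw.
have <- : N (x - y) = N t.
  apply/eqP; rewrite -(eqr_nat C) !NE !PhiE; apply/eqP; congr (_ * Phi _).
  by apply/eqP; rewrite -kl !kN xyw tw.
have sub_inj : injective (fun s => s - y) by exact: addIr.
rewrite -(card_imset _ sub_inj) /N; apply: eq_card => s; rewrite [RHS]inE.
apply/imsetP/idP => [[s' + ->]|/andP [hu hv]].
  by rewrite inE !RE opprB addrA subrK.
exists (s + y); rewrite ?addrK // inE !RE addrK hv andbT.
by rewrite opprD addrA addrAC.
Qed.

End LabelScheme.
(** * The case of subspaces *)

Section SubspaceTransform.

Variables (p n : nat) (C : numClosedFieldType) (z : C).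
Hypotheses (p_pr : prime p) (z_prim : p.-primitive_root z).

Local Notation V := 'rV['F_p]_n.
Local Notation e := (@ezeta p C z).
Local Notation ft := (@ft p n C z).

Variables (U : {vspace V}) (B : {set V}).
Hypothesis BE : B = [set x in U].

Lemma subspace0 : 0 \in B. Proof. by rewrite BE inE mem0v. Qed.

Lemma subspaceD x y : x \in B -> (x + y \in B) = (y \in B).
Proof. by rewrite BE !inE; exact: rpredDl. Qed.

Lemma subspaceZ a x : a != 0 -> (a *: x \in B) = (x \in B).
Proof. by move=> a0; rewrite BE !inE rpredZeq (negPf a0). Qed.

Lemma subspaceN x : (- x \in B) = (x \in B).
Proof. by rewrite BE !inE rpredN. Qed.

Lemma card_subspace : #|B| = (p ^ \dim U)%N.
Proof. by rewrite BE cardsE; have := card_vspace U; rewrite card_Fp. Qed.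

Lemma orthocP x : reflect (forall y, y \in B -> dotp x y = 0) (x \in orthoc B).
Proof. by rewrite inE; apply: (iffP forall_inP) => h y /h => [/eqP|->]. Qed.

(** If some b in B has y.b nonzero, translation by b multiplies the sum by a root of unity other
    than 1. *)
Lemma ft_subspace y : ft (fun x => (x \in B)%:R) y = #|B|%:R * (y \in orthoc B)%:R.
Proof.
have ftE : ft (fun x => (x \in B)%:R) y = \sum_(x in B) e (- dotp y x).
  rewrite [RHS]big_mkcond; apply: eq_bigr => x _.
  by case: (x \in B); rewrite ?mul1r ?mul0r.
rewrite ftE; case: orthocP => [yB|].
  rewrite (eq_bigr (fun=> 1)) => [|x /yB ->]; last by rewrite oppr0 ezeta0.
  by rewrite sumr_const mulr1.
move=> yB; have [b bB yb] : exists2 b, b \in B & dotp y b != 0.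
  case: (pickP [pred b in B | dotp y b != 0]) => [b /andP [bB yb]|no].
    by exists b.
  by case: yB => b bB; apply/eqP; have := no b; rewrite /= bB => /negbFE.
have eb : 1 - e (- dotp y b) != 0.
  by rewrite subr_eq0 eq_sym -(@ezeta0 p _ z) (inj_eq (ezeta_inj p_pr z_prim)) oppr_eq0.
apply: (mulfI eb); rewrite !mulr0 mulrBl mul1r mulr_sumr.
rewrite [X in X - _](reindex_inj (addrI b)) /=.
rewrite (eq_bigl (fun x => x \in B)) => [|x]; last by rewrite subspaceD.
rewrite -sumrB big1 // => x _.
by rewrite dotpDr opprD (ezetaD p_pr z_prim) subrr.
Qed.

Lemma card_subspace_neq0 : #|B|%:R != 0 :> C.
Proof. by rewrite pnatr_eq0 card_subspace expn_eq0 eqn0Ngt prime_gt0. Qed.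

Lemma ft_orthoc y :
  ft (fun x => (x \in orthoc B)%:R) y = p%:R ^+ n / #|B|%:R * (y \in B)%:R.
Proof.
apply: (ft_scale_inv p_pr z_prim (phi := fun x => (x \in B)%:R)).
- by move=> x; rewrite subspaceN.
- exact: card_subspace_neq0.
exact: ft_subspace.
Qed.

(** The transform of the indicator of [orthoc B] at 0 counts [orthoc B]. *)
Lemma card_orthoc : (#|B| * #|orthoc B| = p ^ n)%N.
Proof.
have := ft_orthoc 0; rewrite subspace0 mulr1.
have -> : ft (fun x => (x \in orthoc B)%:R) 0 = #|orthoc B|%:R.
  rewrite /ft -[in RHS]sum1_card natr_sum [RHS]big_mkcond /=; apply: eq_bigr => x _.
  by rewrite dotp0l oppr0 ezeta0 mulr1; case: (_ \in _).
move=> h; apply/eqP; rewrite -(eqr_nat C) natrM h mulrC divfK ?natrX //.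
exact: card_subspace_neq0.
Qed.

Lemma orthoc_invariant (phi : V -> C) y : (forall x, x \notin B -> phi x = 0) ->
  y \in orthoc B -> ft phi y = ft phi 0.
Proof.
move=> phiB /orthocP yB; apply: eq_bigr => x _.
by case: (boolP (x \in B)) => [/yB ->|/phiB ->]; rewrite ?mul0r ?dotp0l.
Qed.

Lemma orthoc0 : 0 \in orthoc B.
Proof. by apply/orthocP => y _; rewrite dotp0l. Qed.

Lemma orthocN x : (- x \in orthoc B) = (x \in orthoc B).
Proof.
by apply/orthocP/orthocP => h y yB; [rewrite -[x]opprK|]; rewrite dotpNl h ?oppr0.
Qed.

End SubspaceTransform.
Lemma homogeneous_even (p n h : nat) (f : 'rV['F_p]_n -> 'F_p) : prime p -> odd p ->
  (0 < h)%N -> coprime (h - 1) (p - 1) ->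
  (forall a x, a != 0 -> f (a *: x) = a ^+ h * f x) -> forall x, f (- x) = f x.
Proof.
move=> p_pr p_odd h_gt0 h_coprime f_homog x.
have h_even := even_of_coprime_pred (prime_gt0 p_pr) p_odd h_gt0 h_coprime.
rewrite -scaleN1r f_homog ?oppr_eq0 ?oner_eq0 // -signr_odd (negPf h_even).
by rewrite mul1r.
Qed.

Section SubspacePair.

Variables (R : realType) (p n r h : nat).
Hypotheses (p_pr : prime p) (p_odd : odd p) (n_odd : odd n).

Local Notation V := 'rV['F_p]_n.
Local Notation z := (xi R p).
Local Notation e := (@ezeta p _ z).
Local Notation eta := (@legendre p).
Local Notation g := (walsh_unit R p n).
Local Notation G := (gauss p z).
Let z_prim := xi_prim R p_pr p_odd.

Variable f : V -> 'F_p.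
Hypotheses (f_bent : bent R f) (dual_bent_f : bent R (dual R f)) (f0 : f 0 = 0).
Hypotheses (h_gt0 : (0 < h)%N) (h_coprime : coprime (h - 1) (p - 1)).
Hypothesis f_homog : forall a x, a != 0 -> f (a *: x) = a ^+ h * f x.

Local Notation D := (dual R f).
Local Notation A := (dual_side R f).
Local Notation S := (Bplus R D).

Variables UA US : {vspace V}.
Hypotheses (AE : A = [set x in UA]) (SE : S = [set x in US]).

Let f_even := homogeneous_even p_pr p_odd h_gt0 h_coprime f_homog.
Let D_even := dual_even R p_pr p_odd f_even.
Let D0 := dual0 p_pr p_odd n_odd f_bent f_even f0.
Let g_neq0 := walsh_unit_neq0 R p_pr p_odd n_odd.
Let G_neq0 := gauss_neq0 R p_pr p_odd.
Let pn0 : (p%:R : R[i]) ^+ n != 0.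
Proof. by rewrite expf_neq0 // pnatr_eq0 -lt0n prime_gt0. Qed.

Let in_hyp x : ft z (fun a => (a \in A)%:R * e (D a)) x =
  1%:~R * g * ((x \in S)%:R * e (f x)).
Proof. by rewrite mul1r ft_dual_in. Qed.

Let out_hyp x : ft z (fun a => (a \in ~: A)%:R * e (D a)) x =
  (-1)%:~R * g * ((x \in ~: S)%:R * e (f x)).
Proof.
rewrite rmorphN1 mulN1r in_setC -ft_dual_out //.
by apply: eq_ft => a; rewrite in_setC.
Qed.

Let S_scale a x : a != 0 -> (a *: x \in S) = (x \in S).
Proof. exact: subspaceZ SE _ _. Qed.

Let SC_scale a x : a != 0 -> (a *: x \in ~: S) = (x \in ~: S).
Proof. by move=> a0; rewrite !in_setC S_scale. Qed.

Lemma ft_in_delta y :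
  ft z (fun a => (a \in A)%:R * (p%:R * (D a == 0)%:R - 1)) y =
  g * G * ((y \in S)%:R * (eta (f y))%:~R).
Proof.
by rewrite (ft_dual_delta p_pr p_odd n_odd h_gt0 h_coprime f_homog _ S_scale in_hyp) mul1r.
Qed.

Lemma ft_in_legendre y : ft z (fun a => (a \in A)%:R * (eta (D a))%:~R) y =
  g / G * ((y \in S)%:R * (p%:R * (f y == 0)%:R - 1)).
Proof.
by rewrite (ft_dual_legendre p_pr p_odd n_odd h_gt0 h_coprime f_homog _ S_scale in_hyp) mul1r.
Qed.

Lemma ft_out_delta y :
  ft z (fun a => (a \notin A)%:R * (p%:R * (D a == 0)%:R - 1)) y =
  - g * G * ((y \notin S)%:R * (eta (f y))%:~R).
Proof.
have := ft_dual_delta p_pr p_odd n_odd h_gt0 h_coprime f_homog y SC_scale out_hyp.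
rewrite rmorphN1 mulN1r !in_setC => <-.
by apply: eq_ft => a; rewrite in_setC.
Qed.

Lemma ft_out_legendre y : ft z (fun a => (a \notin A)%:R * (eta (D a))%:~R) y =
  - g / G * ((y \notin S)%:R * (p%:R * (f y == 0)%:R - 1)).
Proof.
have := ft_dual_legendre p_pr p_odd n_odd h_gt0 h_coprime f_homog y SC_scale out_hyp.
rewrite rmorphN1 mulN1r !in_setC => <-.
by apply: eq_ft => a; rewrite in_setC.
Qed.

Let A_even := dual_side_even p_pr p_odd n_odd f_bent f_even.

Lemma ft_in_inv a : ft z (fun x => (x \in S)%:R * e (f x)) a =
  p%:R ^+ n / g * ((a \in A)%:R * e (D a)).
Proof.
apply: (ft_scale_inv p_pr z_prim (phi := fun a => (a \in A)%:R * e (D a))) => //.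
  by move=> x; rewrite A_even D_even.
by move=> x; rewrite in_hyp mul1r.
Qed.

Lemma ft_in_delta_inv a :
  ft z (fun x => (x \in S)%:R * (p%:R * (f x == 0)%:R - 1)) a =
  p%:R ^+ n / (g / G) * ((a \in A)%:R * (eta (D a))%:~R).
Proof.
apply: (ft_scale_inv p_pr z_prim (phi := fun a => (a \in A)%:R * (eta (D a))%:~R)).
- by move=> x; rewrite A_even D_even.
- by rewrite mulf_neq0 ?invr_eq0.
exact: ft_in_legendre.
Qed.

Lemma ft_in_legendre_inv a : ft z (fun x => (x \in S)%:R * (eta (f x))%:~R) a =
  p%:R ^+ n / (g * G) * ((a \in A)%:R * (p%:R * (D a == 0)%:R - 1)).
Proof.
apply: (ft_scale_inv p_pr z_prim
  (phi := fun a => (a \in A)%:R * (p%:R * (D a == 0)%:R - 1))).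
- by move=> x; rewrite A_even D_even.
- by rewrite mulf_neq0.
exact: ft_in_delta.
Qed.

Lemma ft_out_delta_inv a :
  ft z (fun x => (x \notin S)%:R * (p%:R * (f x == 0)%:R - 1)) a =
  p%:R ^+ n / (- g / G) * ((a \notin A)%:R * (eta (D a))%:~R).
Proof.
apply: (ft_scale_inv p_pr z_prim (phi := fun a => (a \notin A)%:R * (eta (D a))%:~R)).
- by move=> x; rewrite A_even D_even.
- by rewrite mulf_neq0 ?invr_eq0 ?oppr_eq0.
exact: ft_out_legendre.
Qed.

Lemma ft_out_legendre_inv a : ft z (fun x => (x \notin S)%:R * (eta (f x))%:~R) a =
  p%:R ^+ n / (- g * G) * ((a \notin A)%:R * (p%:R * (D a == 0)%:R - 1)).
Proof.
apply: (ft_scale_inv p_pr z_prim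
  (phi := fun a => (a \notin A)%:R * (p%:R * (D a == 0)%:R - 1))).
- by move=> x; rewrite A_even D_even.
- by rewrite mulf_neq0 ?oppr_eq0.
exact: ft_out_delta.
Qed.

(** A transform of a function supported on A takes the same value at x as at 0; for 1_A e(D) these
    values are g 1_S(x) e(f x) and g. *)
Lemma orthoc_dual_side x : x \in orthoc A -> x \in S /\ f x = 0.
Proof.
move=> xA.
have : ft z (fun a => (a \in A)%:R * e (D a)) x =
       ft z (fun a => (a \in A)%:R * e (D a)) 0.
  by apply: orthoc_invariant xA => a /negPf ->; rewrite mul0r.
rewrite !ft_dual_in // f0 ezeta0 (subspace0 SE) mulr1 => /(mulfI g_neq0).
case: (x \in S) => [|/eqP]; last by rewrite mul0r eq_sym oner_eq0.
rewrite mul1r => h1.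
by split=> //; apply: (ezeta_inj p_pr z_prim); rewrite h1 ezeta0.
Qed.

Lemma orthoc_Bplus a : a \in orthoc S -> a \in A /\ D a = 0.
Proof.
move=> aS.
have : ft z (fun x => (x \in S)%:R * e (f x)) a =
       ft z (fun x => (x \in S)%:R * e (f x)) 0.
  by apply: orthoc_invariant aS => x /negPf ->; rewrite mul0r.
have k0 : p%:R ^+ n / g != 0 by rewrite mulf_neq0 ?invr_eq0.
rewrite !ft_in_inv D0 ezeta0 (subspace0 AE) mulr1 => /(mulfI k0).
case: (a \in A) => [|/eqP]; last by rewrite mul0r eq_sym oner_eq0.
rewrite mul1r => h1.
by split=> //; apply: (ezeta_inj p_pr z_prim); rewrite h1 ezeta0.
Qed.

Lemma ft_factors_dual phi : factors (label (orthoc S) A D) phi ->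
  factors (label (orthoc A) S f) (ft z phi).
Proof.
apply: (ft_factors p_pr z_prim (orthoc0 S) _ _ (ft_orthoc p_pr z_prim SE)
  (ft_subspace p_pr z_prim AE) ft_in_delta ft_in_legendre ft_out_delta ft_out_legendre).
- by move=> x /orthoc_Bplus [].
- by move=> x /orthoc_Bplus [].
Qed.

Lemma ft_factors_dual_inv phi : factors (label (orthoc A) S f) phi ->
  factors (label (orthoc S) A D) (ft z phi).
Proof.
apply: (ft_factors p_pr z_prim (orthoc0 A) _ _ (ft_orthoc p_pr z_prim AE)
  (ft_subspace p_pr z_prim SE) ft_in_delta_inv ft_in_legendre_inv
  ft_out_delta_inv ft_out_legendre_inv).
- by move=> x /orthoc_dual_side [].
- by move=> x /orthoc_dual_side [].
Qed.


(** * Counting zeros, squares and nonsquares on S and off S *)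

Definition count_values (B : {set V}) (P : pred 'F_p) : nat :=
  #|[set x in B | P (f x)]|.
Local Notation cnt := count_values.
Local Notation zr := (fun y : 'F_p => y == 0%R).
Local Notation sq := (fun y : 'F_p => y \in SQ p).
Local Notation nsq := (fun y : 'F_p => y \in NSQ p).

Lemma sum_count_values (B : {set V}) (P : pred 'F_p) :
  \sum_x (x \in B)%:R * (P (f x))%:R = (cnt B P)%:R :> R[i].
Proof.
rewrite /cnt -sum1_card natr_sum [RHS]big_mkcond /=; apply: eq_bigr => x _.
by rewrite inE; case: (x \in B); case: (P _); rewrite ?mulr1 ?mulr0.
Qed.

Lemma NSQE (a : 'F_p) : (a \in NSQ p) = (a != 0) && (a \notin SQ p).
Proof. by rewrite !inE; case: eqP. Qed.

Lemma count_values_total (B : {set V}) :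
  #|B| = (cnt B zr + cnt B sq + cnt B nsq)%N.
Proof.
apply/eqP; rewrite -(eqr_nat R[i]) !natrD -!sum_count_values -!big_split /=.
rewrite -sum1_card natr_sum big_mkcond; apply/eqP; apply: eq_bigr => x _ /=.
case: (x \in B); rewrite ?mul0r ?addr0 // !mul1r !inE.
by case: (f x == 0); case: [exists b, _]; rewrite /= ?addr0 ?add0r.
Qed.

Lemma sum_delta (B : {set V}) :
  \sum_x (x \in B)%:R * (p%:R * (f x == 0)%:R - 1) =
  p%:R * (cnt B zr)%:R - #|B|%:R :> R[i].
Proof.
rewrite -sum_count_values mulr_sumr -sum1_card natr_sum [X in _ - X]big_mkcond -sumrB.
apply: eq_bigr => x _ /=.
by case: (x \in B); rewrite ?mul0r ?mul1r ?mulr0 ?subr0.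
Qed.

Lemma sum_legendre (B : {set V}) :
  \sum_x (x \in B)%:R * (eta (f x))%:~R =
  (cnt B sq)%:R - (cnt B nsq)%:R :> R[i].
Proof.
rewrite -!sum_count_values -sumrB; apply: eq_bigr => x _ /=.
rewrite -mulrBr NSQE legendre_SQ; congr (_ * _).
case: eqVneq => [->|_]; first by rewrite !inE eqxx subr0.
by case: (_ \in SQ p); rewrite ?rmorphN1 ?subr0 ?sub0r.
Qed.

Let ft_at0 (phi : V -> R[i]) : ft z phi 0 = \sum_x phi x.
Proof. by apply: eq_bigr => x _; rewrite dotp0l oppr0 ezeta0 mulr1. Qed.

Hypotheses (dimA : \dim UA = r) (dimS : \dim US = r).

(** At 0 the transform of 1_S (p [f = 0] - 1) is a multiple of eta(D 0) = 0. *)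
Lemma count_in0 : (p * cnt S zr = p ^ r)%N.
Proof.
have := ft_in_delta_inv 0; rewrite ft_at0 sum_delta D0 legendre0 !mulr0.
rewrite (card_subspace p_pr SE) dimS => /eqP.
by rewrite subr_eq0 -natrM eqr_nat => /eqP.
Qed.

(* Here the sign of the Gauss sum matters: g^* / G = eta(-1) p^((n-1)/2). *)
Lemma count_in_legendre :
  (cnt S sq)%:Z - (cnt S nsq)%:Z =
  eta (-1) * (p ^ n./2 * (p - 1))%:Z.
Proof.
apply: (@intr_inj R[i]).
have := ft_in_legendre_inv 0; rewrite ft_at0 sum_legendre D0 eqxx (subspace0 AE).
rewrite rmorphB /= => ->; rewrite rmorphM /=.
rewrite -[(_%:Z)%:~R]/((p ^ n./2 * (p - 1))%:R : R[i]) natrM natrB ?prime_gt0 // natrX.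
rewrite -(walsh_unit_norm R p_pr p_odd n_odd) walsh_unit_conj // walsh_unitE //.
have P0 : (p%:R : R[i]) ^+ n./2 != 0 by rewrite expf_neq0 // pnatr_eq0 -lt0n prime_gt0.
by field; rewrite P0 G_neq0.
Qed.

Lemma count_out0 : (p * cnt (~: S) zr = p ^ n - p ^ r)%N.
Proof.
have := ft_out_delta_inv 0; rewrite D0 legendre0 !mulr0.
rewrite (eq_ft z (psi := fun x => (x \in ~: S)%:R * (p%:R * (f x == 0)%:R - 1))); last first.
  by move=> x; rewrite in_setC.
rewrite ft_at0 sum_delta cardsCs setCK (card_rV n p_pr) (card_subspace p_pr SE) dimS => /eqP.
by rewrite subr_eq0 -natrM eqr_nat => /eqP.
Qed.

(** The transform is supported off A, and 0 lies in the subspace A. *)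
Lemma count_out_legendre : cnt (~: S) sq = cnt (~: S) nsq.
Proof.
have := ft_out_legendre_inv 0; rewrite (subspace0 AE) mul0r mulr0.
rewrite (eq_ft z (psi := fun x => (x \in ~: S)%:R * (eta (f x))%:~R)); last first.
  by move=> x; rewrite in_setC.
by rewrite ft_at0 sum_legendre => /eqP; rewrite subr_eq0 eqr_nat => /eqP.
Qed.

Lemma card_orthoc_side : (p ^ r * #|orthoc A| = p ^ n)%N.
Proof.
by rewrite -dimA -(card_subspace p_pr AE); exact: (card_orthoc p_pr z_prim AE).
Qed.

Lemma count_valuesP (B : {set V}) (P : pred 'F_p) :
  (0 < cnt B P)%N -> exists2 x, x \in B & P (f x).
Proof. by rewrite card_gt0 => /set0Pn [x]; rewrite inE => /andP []; exists x. Qed.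

Let half_n : n = (2 * n./2).+1.
Proof. by rewrite mul2n -[LHS]odd_double_half n_odd. Qed.

Let p_gt2 : (2 < p)%N := odd_prime_gt2 p_odd p_pr.

(** Zeros form a p-th part of the nonempty complement of S, and squares and nonsquares share the
    rest equally. *)
Lemma value_out (P : pred 'F_p) : (r < n)%N ->
  P = zr \/ P = sq \/ P = nsq ->
  exists2 x, x \notin S & P (f x).
Proof.
move=> rn PE.
suff /count_valuesP [x xS Px] : (0 < cnt (~: S) P)%N by exists x; rewrite // -in_setC.
have pos : (p ^ r < p ^ n)%N by rewrite ltn_exp2l // prime_gt1.
have := count_values_total (~: S); rewrite cardsCs setCK (card_rV n p_pr).
rewrite (card_subspace p_pr SE) dimS -count_out0 -count_out_legendre.
have : (0 < cnt (~: S) zr)%N.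
  by rewrite -(ltn_pmul2l (prime_gt0 p_pr)) muln0 count_out0 subn_gt0.
case: PE => [->//|[->|->]]; rewrite -?count_out_legendre; move: p_gt2; nia.
Qed.

Lemma orthoc_neq0 : (r < n)%N -> exists2 x, x \in orthoc A & x != 0.
Proof.
move=> rn; have oA1 : (1 < #|orthoc A|)%N.
  rewrite -(ltn_pmul2l (m := p ^ r)) ?expn_gt0 ?prime_gt0 // muln1 card_orthoc_side.
  by rewrite ltn_exp2l // prime_gt1.
have /subsetPn [x xA] : ~~ (orthoc A \subset [set 0]).
  by apply/negP => /subset_leq_card; rewrite cards1 leqNgt oA1.
by rewrite inE => x0; exists x.
Qed.

Lemma orthoc_zeros_sub : orthoc A \subset [set x in S | f x == 0].
Proof. by apply/subsetP => x /orthoc_dual_side [xS fx]; rewrite inE xS fx eqxx. Qed.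

Section Minimal.

Hypothesis rE : r = n./2.+1.

Let count0 : cnt S zr = (p ^ n./2)%N.
Proof.
by apply/eqP; rewrite -(eqn_pmul2l (prime_gt0 p_pr)) count_in0 rE expnS.
Qed.

(** The inclusion is an equality because n - r = r - 1 = (n-1)/2 gives both sets the same size. *)
Lemma orthoc_zeros x : (x \in orthoc A) = (x \in S) && (f x == 0).
Proof.
suff -> : orthoc A = [set x in S | f x == 0] by rewrite inE.
apply/eqP; rewrite eqEcard orthoc_zeros_sub /=.
rewrite -[X in (X <= _)%N]/(cnt S zr) count0.
rewrite -(leq_pmul2l (m := p ^ r)) ?expn_gt0 ?prime_gt0 // card_orthoc_side.
by rewrite rE -expnD leq_exp2l ?prime_gt1 //; move: half_n; lia.
Qed.

(** On S there are (p - 1) p^((n-1)/2) points with nonzero value, as many as the absolute difference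
    between the square and the nonsquare counts. So one kind is absent, and eta(-1) decides
    which. *)
Lemma count_min :
  if (p %% 4 == 1)%N then (cnt S nsq = 0 /\ 0 < cnt S sq)%N
  else (cnt S sq = 0 /\ 0 < cnt S nsq)%N.
Proof.
have := count_values_total S; rewrite (card_subspace p_pr SE) dimS count0 rE expnS.
have := count_in_legendre; rewrite (legendreN1_mod4 p_pr p_odd).
have : (0 < p ^ n./2)%N by rewrite expn_gt0 prime_gt0.
move: (p ^ n./2)%N (cnt _ _) (cnt _ _) p_gt2 => P b c.
by case: ifP => _; nia.
Qed.

End Minimal.

Section NonMinimal.

Hypothesis r_gt : (n./2.+1 < r)%N.

Let count0_gt : (p ^ n./2 < cnt S zr)%N.
Proof.
rewrite -(ltn_pmul2l (prime_gt0 p_pr)) count_in0 -expnS ltn_exp2l //.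
exact: prime_gt1.
Qed.

(** There are p^(r-1) zeros on S but only p^(n-r) points in orth(A), and now r - 1 > n - r. *)
Lemma zeros_notin_orthoc : (r <= n)%N ->
  exists2 x, x \in S & (f x == 0) && (x \notin orthoc A).
Proof.
move=> rn; have : ~~ ([set x in S | f x == 0] \subset orthoc A).
  apply/negP => /subset_leq_card; rewrite -[X in (X <= _)%N]/(cnt S zr).
  apply/negP; rewrite -ltnNge; apply: leq_trans count0_gt; rewrite ltnS.
  rewrite -(leq_pmul2l (m := p ^ r)) ?expn_gt0 ?prime_gt0 // card_orthoc_side.
  by rewrite -expnD leq_exp2l ?prime_gt1 //; move: half_n r_gt; lia.
by case/subsetPn => x; rewrite inE => /andP [xS fx] xA; exists x; rewrite ?fx.
Qed.

(** The (p - 1) p^(r-1) points of S with nonzero value now outnumber the difference (p - 1)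
    p^((n-1)/2), so both kinds occur. *)
Lemma count_nonmin : (0 < cnt S sq)%N && (0 < cnt S nsq)%N.
Proof.
have := count_values_total S; rewrite (card_subspace p_pr SE) dimS -count_in0.
have := count_in_legendre; rewrite (legendreN1_mod4 p_pr p_odd); move: count0_gt.
move: (p ^ n./2)%N (cnt _ _) (cnt _ _) (cnt _ _) p_gt2 => P b c d.
by case: ifP => _; nia.
Qed.

End NonMinimal.

(** * From labels to the classes of the schemes *)

Definition label_valid (l : bool * bool * bool * bool * bool) : bool :=
  let: (x0, xP, xS, d, s) := l in
  [&& x0 ==> xP, xP ==> xS && d & d ==> ~~ s].

(** The numbering follows the tuples [U20] and [U21]; it separates valid labels only. *)
Definition label_index8 (l : bool * bool * bool * bool * bool) : nat :=
  let: (x0, xP, xS, d, s) := l in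
  if x0 then 0 else if xP then 1 else
  if xS then if d then 2 else if s then 3 else 4
  else if d then 5 else if s then 6 else 7.

Definition label_index6 (l : bool * bool * bool * bool * bool) : nat :=
  let: (x0, xP, xS, d, s) := l in
  if x0 then 0 else if xP then 1 else if xS then 2
  else if d then 3 else if s then 4 else 5.

(** The additional constraints for r = (n+1)/2: the zeros on S are exactly orth(A), and [q] tells
    whether the nonzero values on S are all squares or all nonsquares. *)
Definition label_valid6 (q : bool) (l : bool * bool * bool * bool * bool) : bool :=
  let: (x0, xP, xS, d, s) := l in
  label_valid l && (xS ==> (d == xP)) && (xS && ~~ d ==> (s == q)).

Lemma label_index8_inj l l' : label_valid l -> label_valid l' ->
  (label_index8 l == label_index8 l') = (l == l').
Proof.
move: l l' => [[[[[] []] []] []] []] [[[[x0' xP'] xS'] d'] s'] //= _;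
by case: x0'; case: xP'; case: xS'; case: d'; case: s'.
Qed.

Lemma label_index6_inj q l l' : label_valid6 q l -> label_valid6 q l' ->
  (label_index6 l == label_index6 l') = (l == l').
Proof.
by move: q l l' => [] [[[[[] []] []] []] []] [[[[x0' xP'] xS'] d'] s'] //= _;
  case: x0'; case: xP'; case: xS'; case: d'; case: s'.
Qed.

Local Notation lab := (label (orthoc A) S f).

Lemma label_validP x : label_valid (lab x).
Proof.
rewrite /label /=; apply/and3P; split; apply/implyP.
- by move=> /eqP ->; apply: orthoc0.
- by move=> /orthoc_dual_side [-> ->]; rewrite eqxx.
by move=> /eqP ->; rewrite inE eqxx.
Qed.

Lemma labelN x : lab (- x) = lab x.
Proof. by rewrite /label oppr_eq0 orthocN (subspaceN SE) f_even. Qed.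

Lemma in_cset x j : (x \in cset R f j) = (x \in S) && (f x == j).
Proof. by rewrite inE. Qed.

Lemma in_dset x j : (x \in dset R f j) = (x \notin S) && (f x == j).
Proof. by rewrite inE bent_Bminus // in_setC. Qed.

Lemma in_bigcup_value (I : {set 'F_p}) (F : 'F_p -> {set V}) (b : bool) x :
  (forall j, (x \in F j) = b && (f x == j)) ->
  (x \in \bigcup_(i in I) F i) = b && (f x \in I).
Proof.
move=> FE; apply/bigcupP/andP => [[i iI]|[Bx fx]].
  by rewrite FE => /andP [-> /eqP ->].
by exists (f x); rewrite // FE Bx eqxx.
Qed.

Lemma in_bigcup_cset (I : {set 'F_p}) x :
  (x \in \bigcup_(i in I) cset R f i) = (x \in S) && (f x \in I).
Proof. exact: (in_bigcup_value I (in_cset x)). Qed.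

Lemma in_bigcup_dset (I : {set 'F_p}) x :
  (x \in \bigcup_(i in I) dset R f i) = (x \notin S) && (f x \in I).
Proof. exact: (in_bigcup_value I (in_dset x)). Qed.

Lemma label_index8_eq0 x : (label_index8 (lab x) == 0%N) = (x == 0).
Proof. by rewrite /=; do 5!case: ifP => //. Qed.

Lemma scheme8 : (n./2.+1 < r)%N -> (r < n)%N ->
  induces_symmetric_scheme 7
    [tuple [set 0]; orthoc A :\ 0; cset R f 0 :\: orthoc A;
           \bigcup_(i in SQ p) cset R f i; \bigcup_(i in NSQ p) cset R f i;
           dset R f 0; \bigcup_(i in SQ p) dset R f i;
           \bigcup_(i in NSQ p) dset R f i].
Proof.
move=> r_gt r_lt.
pose k x : 'I_8 := inord (label_index8 (lab x)).
have kE x : k x = label_index8 (lab x) :> nat.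
  by rewrite inordK //=; do 7!case: ifP => //.
apply: (scheme_of_labels p_pr z_prim (k := k) (l := lab) (l' := label (orthoc S) A D)).
- move=> i x; rewrite -val_eqE /= kE (tnth_nth set0) /=.
  case: i => [[|[|[|[|[|[|[|[|//]]]]]]]] ?] /=; have := label_validP x;
    rewrite ?(in_set1, in_setD1, in_setD, in_bigcup_cset, in_bigcup_dset, in_cset,
              in_dset, NSQE) /label /=;
    case: (x == 0); case: (x \in orthoc A); case: (x \in S); case: (f x == 0);
    by case: (f x \in SQ p).
(* Every class is nonempty; the counts provide one witness for each. *)
- move=> i; suff [x xi] : exists x, label_index8 (lab x) = i.
    by exists x; apply: val_inj; rewrite /= kE.
  have [x1 x1P x10] := orthoc_neq0 r_lt.
  have [x2 x2S /andP [x2f x2P]] := zeros_notin_orthoc r_gt (ltnW r_lt).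
  have /andP [/count_valuesP [x3 x3S x3f] /count_valuesP [x4 x4S x4f]] := count_nonmin r_gt.
  have [x5 x5S x5f] := value_out r_lt (or_introl (erefl zr)).
  have [x6 x6S x6f] := value_out r_lt (or_intror (or_introl (erefl sq))).
  have [x7 x7S x7f] := value_out r_lt (or_intror (or_intror (erefl nsq))).
  move: x4f x7f; rewrite !NSQE => /andP [x4f x4q] /andP [x7f x7q].
  case: i => [[|[|[|[|[|[|[|[|//]]]]]]]] ?] /=;
    [exists 0|exists x1|exists x2|exists x3|exists x4|exists x5|exists x6|exists x7].
  + by rewrite eqxx.
  + by rewrite (negPf x10) x1P.
  + have := label_validP x2; rewrite /label /= x2S x2f (negPf x2P).
    by case: (x2 == 0).
  + have := label_validP x3; rewrite /label /= x3S x3f.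
    by case: (x3 == 0); case: (x3 \in orthoc A); case: (f x3 == 0).
  + have := label_validP x4; rewrite /label /= x4S (negPf x4f) (negPf x4q).
    by case: (x4 == 0); case: (x4 \in orthoc A).
  + have := label_validP x5; rewrite /label /= (negPf x5S) x5f.
    by case: (x5 == 0); case: (x5 \in orthoc A).
  + have := label_validP x6; rewrite /label /= (negPf x6S) x6f.
    by case: (x6 == 0); case: (x6 \in orthoc A); case: (f x6 == 0).
  + have := label_validP x7; rewrite /label /= (negPf x7S) (negPf x7f) (negPf x7q).
    by case: (x7 == 0); case: (x7 \in orthoc A).
- by move=> x; rewrite -val_eqE /= kE label_index8_eq0.
- by move=> x; rewrite /k labelN.
- move=> x y; rewrite -val_eqE /= !kE label_index8_inj ?label_validP //.
- exact: ft_factors_dual_inv.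
exact: ft_factors_dual.
Qed.

Lemma label_valid6P x : r = n./2.+1 -> label_valid6 (p %% 4 == 1)%N (lab x).
Proof.
move=> rE; rewrite /label_valid6 {1}/label label_validP /=; apply/andP; split.
  by apply/implyP => xS; rewrite orthoc_zeros // xS.
apply/implyP => /andP [xS fx].
have pos (P : pred 'F_p) : P (f x) -> (0 < cnt S P)%N.
  by move=> Px; rewrite card_gt0; apply/set0Pn; exists x; rewrite inE xS.
have := count_min rE; case: ifP => _ [c0 _]; apply/eqP.
  by apply: contraTT isT => xq; have := pos nsq; rewrite NSQE fx xq c0 => /(_ isT).
by apply: negbTE; apply/negP => xq; have := pos sq xq; rewrite c0.
Qed.

(** The conditional index set is the quadratic type that survives on S by [count_min]; this is the
    difference between [U18] and [U19]. *)
Lemma scheme6 : r = n./2.+1 -> (r < n)%N ->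
  induces_symmetric_scheme 5
    [tuple [set 0]; cset R f 0 :\ 0;
           \bigcup_(i in if (p %% 4 == 1)%N then SQ p else NSQ p) cset R f i;
           dset R f 0; \bigcup_(i in SQ p) dset R f i;
           \bigcup_(i in NSQ p) dset R f i].
Proof.
move=> rE r_lt.
pose k x : 'I_6 := inord (label_index6 (lab x)).
have kE x : k x = label_index6 (lab x) :> nat.
  by rewrite inordK //=; do 5!case: ifP => //.
apply: (scheme_of_labels p_pr z_prim (k := k) (l := lab) (l' := label (orthoc S) A D)).
- move=> i x; rewrite -val_eqE /= kE (tnth_nth set0) /=; have := label_valid6P x rE.
  case: (p %% 4 == 1)%N; case: i => [[|[|[|[|[|[|//]]]]]] ?] /=;
    rewrite ?(in_set1, in_setD1, in_setD, in_bigcup_cset, in_bigcup_dset, in_cset,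
              in_dset, NSQE) /label /=;
    case: (x == 0); case: (x \in orthoc A); case: (x \in S); case: (f x == 0);
    by case: (f x \in SQ p).
- move=> i; suff [x xi] : exists x, label_index6 (lab x) = i.
    by exists x; apply: val_inj; rewrite /= kE.
  have [x1 x1P x10] := orthoc_neq0 r_lt.
  have [x2 x2S x2f] : exists2 x, x \in S & f x != 0.
    by have := count_min rE; case: ifP => _ [_ /count_valuesP [x xS]];
      rewrite inE => /andP [fx _]; exists x.
  have [x5 x5S x5f] := value_out r_lt (or_introl (erefl zr)).
  have [x6 x6S x6f] := value_out r_lt (or_intror (or_introl (erefl sq))).
  have [x7 x7S x7f] := value_out r_lt (or_intror (or_intror (erefl nsq))).
  move: x7f; rewrite !NSQE => /andP [x7f x7q].
  case: i => [[|[|[|[|[|[|//]]]]]] ?] /=;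
    [exists 0|exists x1|exists x2|exists x5|exists x6|exists x7].
  + by rewrite eqxx.
  + by rewrite (negPf x10) x1P.
  + have := label_validP x2; rewrite /label /= x2S (negPf x2f).
    by case: (x2 == 0); case: (x2 \in orthoc A).
  + have := label_validP x5; rewrite /label /= (negPf x5S) x5f.
    by case: (x5 == 0); case: (x5 \in orthoc A).
  + have := label_validP x6; rewrite /label /= (negPf x6S) x6f.
    by case: (x6 == 0); case: (x6 \in orthoc A); case: (f x6 == 0).
  + have := label_validP x7; rewrite /label /= (negPf x7S) (negPf x7f) (negPf x7q).
    by case: (x7 == 0); case: (x7 \in orthoc A).
- by move=> x; rewrite -val_eqE /= kE /=; do 5!case: ifP => //.
- by move=> x; rewrite /k labelN.
- move=> x y; rewrite -val_eqE /= !kE.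
  exact: (label_index6_inj (label_valid6P x rE) (label_valid6P y rE)).
- exact: ft_factors_dual_inv.
exact: ft_factors_dual.
Qed.

End SubspacePair.

Theorem proposition4 (R : realType) (p n r : nat)
  (f : 'rV['F_p]_n -> 'F_p)
  (p_prime : prime p) (p_odd : odd p)
  (n_ge3 : (3 <= n)%N) (n_odd : odd n)
  (f_DBF : DBF R f) (f_nwr : ~ weakly_regular R f)
  (sub1 : (p %% 4 = 1)%N ->
     nondegenerate_subspace r (Bplus R f) /\
     nondegenerate_subspace r (Bplus R (dual R f)))
  (sub3 : (p %% 4 = 3)%N ->
     nondegenerate_subspace r (Bminus R f) /\
     nondegenerate_subspace r (Bplus R (dual R f))) :
  [/\ r = ((n + 1) %/ 2)%N -> (p %% 4 = 1)%N ->
        induces_symmetric_scheme 5 (U18 R f),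
      r = ((n + 1) %/ 2)%N -> (p %% 4 = 3)%N ->
        induces_symmetric_scheme 5 (U19 R f),
      ((n + 1) %/ 2 < r <= n - 1)%N -> (p %% 4 = 1)%N ->
        induces_symmetric_scheme 7 (U20 R f)
    & ((n + 1) %/ 2 < r <= n - 1)%N -> (p %% 4 = 3)%N ->
        induces_symmetric_scheme 7 (U21 R f)].
Proof.
have nE : ((n + 1) %/ 2 = n./2.+1)%N by have := odd_double_half n; rewrite n_odd; lia.
(* The bound n >= 3 enters here: it makes S a proper subspace when r = (n+1)/2. *)
have r_lt : ((n + 1) %/ 2 < n)%N by lia.
rewrite nE in r_lt *.
have [[f_bent dual_bent_f] f0 [h [h_gt0 h_gcd f_homog]]] := f_DBF.
have h_coprime : coprime (h - 1) (p - 1) by rewrite /coprime h_gcd.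
have lt_n : (r <= n - 1)%N -> (r < n)%N by lia.
split=> [rE p4|rE p4|/andP [r_gt r_le] p4|/andP [r_gt r_le] p4].
- have [[UA [AE dA _]] [US [SE dS _]]] := sub1 p4.
  have AE' : dual_side R f = [set x in UA] by rewrite /dual_side p4.
  have := scheme6 p_prime p_odd n_odd f_bent dual_bent_f f0 h_gt0 h_coprime f_homog
    AE' SE dA dS rE.
  by rewrite p4 /=; apply; rewrite rE.
- have [[UA [AE dA _]] [US [SE dS _]]] := sub3 p4.
  have AE' : dual_side R f = [set x in UA] by rewrite /dual_side p4.
  have := scheme6 p_prime p_odd n_odd f_bent dual_bent_f f0 h_gt0 h_coprime f_homog
    AE' SE dA dS rE.
  by rewrite p4 /=; apply; rewrite rE.
- have [[UA [AE dA _]] [US [SE dS _]]] := sub1 p4.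
  have AE' : dual_side R f = [set x in UA] by rewrite /dual_side p4.
  have := scheme8 p_prime p_odd n_odd f_bent dual_bent_f f0 h_gt0 h_coprime f_homog
    AE' SE dA dS r_gt (lt_n r_le).
  by rewrite /dual_side p4.
have [[UA [AE dA _]] [US [SE dS _]]] := sub3 p4.
have AE' : dual_side R f = [set x in UA] by rewrite /dual_side p4.
have := scheme8 p_prime p_odd n_odd f_bent dual_bent_f f0 h_gt0 h_coprime f_homog
  AE' SE dA dS r_gt (lt_n r_le).
by rewrite /dual_side p4.
Qed.
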